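(* The decision problem MINORITY — given a finite idempotent algebra $\mathbf{A}$ as a list of tables of its basic operations, decide whether $\mathbf{A}$ has a minority term — belongs to the complexity class NP (with input size measured by $\|\mathbf{A}\|$).
   Context: Inputs are finite, nonempty lists of tables of basic operations, none nullary; the size of the input is $\|\mathbf{A}\|=\sum_{i\ge1}k_i|A|^i$ where $k_i$ is the number of $i$-ary basic operations. An algebra is idempotent if every basic operation $f$ satisfies $f(x,\dots,x)\approx x$. A minority term is a ternary term $m$ whose interpretation satisfies $m(y,x,x)\approx m(x,y,x)\approx m(x,x,y)\approx y$. *)

(* Defs.v *)
From mathcomp Require Import all_boot.
Set Implicit Arguments. Unset Strict Implicit. Unset Printing Implicit Defensive.

(* The universe is {0, ..., card-1}.  A basic operation is a pair (k, tab)
   with arity k and table tab listing f(x_1,...,x_k) for all tuples, in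
   lexicographic order (x_1 most significant): the entry for (x_1..x_k) is at
   index x_1*card^(k-1) + ... + x_k. *)
Record alg := Alg { card : nat; ops : seq (nat * seq nat) }.

Definition op_wf (n : nat) (o : nat * seq nat) : bool :=
  [&& 0 < o.1, size o.2 == n ^ o.1 & all (fun v => v < n) o.2].

Definition alg_wf (A : alg) : bool :=
  [&& 0 < card A, ops A != [::] & all (op_wf (card A)) (ops A)].

Definition alg_size (A : alg) : nat := \sum_(o <- ops A) card A ^ o.1.

Definition tab_index (n : nat) (xs : seq nat) : nat :=
  foldl (fun acc x => acc * n + x) 0 xs.

Definition apply_op (n : nat) (o : nat * seq nat) (xs : seq nat) : nat :=
  nth 0 o.2 (tab_index n xs).

Definition idempotent (A : alg) : Prop :=
  forall o, o \in ops A -> forall x, x < card A ->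
    apply_op (card A) o (nseq o.1 x) = x.

Inductive term := Var of nat | App of nat & seq term.

Fixpoint term_wf (A : alg) (t : term) : bool :=
  match t with
  | Var i => i < 3
  | App f args => [&& f < size (ops A),
                      size args == (nth (0, [::]) (ops A) f).1
                    & all (term_wf A) args]
  end.

Fixpoint term_eval (A : alg) (x y z : nat) (t : term) : nat :=
  match t with
  | Var i => nth 0 [:: x; y; z] i
  | App f args => apply_op (card A) (nth (0, [::]) (ops A) f)
                           (map (term_eval A x y z) args)
  end.

Definition has_minority_term (A : alg) : Prop :=
  exists m : term, term_wf A m /\
    forall x y, x < card A -> y < card A ->
      [/\ term_eval A y x x m = y, term_eval A x y x m = y
        & term_eval A x x y m = y].

Definition unary (m : nat) : seq bool := rcons (nseq m true) false.

Definition enc_op (o : nat * seq nat) : seq bool :=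
  unary o.1 ++ flatten [seq unary v | v <- o.2].

Definition enc_alg (A : alg) : seq bool :=
  unary (card A) ++ flatten [seq enc_op o | o <- ops A].

Inductive isym := Blank | Bit0 | Bit1 | Mark.
Definition of_bool (b : bool) : isym := if b then Bit1 else Bit0.

Inductive move := MoveL | MoveR | Stay.

Record TM := {
  tm_state : finType;
  tm_sym : finType;
  tm_emb : isym -> tm_sym;
  tm_start : tm_state;
  tm_accept : tm_state;
  tm_delta : tm_state -> tm_sym -> tm_state * tm_sym * move
}.

(* configuration: state, cells left of head (nearest first), head, right *)
Definition config (M : TM) := (tm_state M * seq (tm_sym M) * tm_sym M * seq (tm_sym M))%type.

Definition tm_step (M : TM) (c : config M) : config M :=
  let: (q, l, h, r) := c in
  let: (q', h', mv) := tm_delta q h in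
  let bl := tm_emb M Blank in
  match mv with
  | Stay => (q', l, h', r)
  | MoveL => (q', behead l, head bl l, h' :: r)
  | MoveR => (q', h' :: l, head bl r, behead r)
  end.

Definition tm_init (M : TM) (w cert : seq bool) : config M :=
  let tape := [seq tm_emb M s | s <- map of_bool w ++ Mark :: map of_bool cert] in
  (tm_start M, [::], head (tm_emb M Blank) tape, behead tape).

Definition tm_accepts_within (M : TM) (w cert : seq bool) (T : nat) : Prop :=
  exists t, t <= T /\ (iter t (@tm_step M) (tm_init M w cert)).1.1.1 = tm_accept M.

Definition MINORITY_in_NP : Prop :=
  exists (M : TM) (c d : nat),
    forall A : alg, alg_wf A -> idempotent A ->
      (has_minority_term A <->
       exists cert : seq bool,
         size cert <= c * alg_size A ^ d + c /\
         tm_accepts_within M (enc_alg A) cert (c * alg_size A ^ d + c)).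

(* Main.v *)
(** A minority operation is a Maltsev operation.  Let [R] be the subalgebra of the power
    [A^(3 n^2)] generated by the three tuples that list the arguments of the minority
    identities; a minority term exists iff the tuple of prescribed values lies in [R].
    Call a coordinate [i] with a pair [(a, b)] a fork of a set of tuples when two of its members
    agree before [i] and take the values [a] and [b] at [i].  Given a Maltsev operation,
    every tuple of [R] is obtained coordinate by coordinate from a set having all the forks
    of [R]; when this procedure gets stuck on a tuple computed by one more basic operation,
    that tuple yields a new fork.  There are polynomially many forks, so the prescribed tuple has
    a straight-line derivation of polynomial length.  The Maltsev operation itself need not be
    given by a short program: idempotence lets one glue local Maltsev operations, each
    found in a subalgebra of [A^2], hence in at most [n^2] steps.

    A certificate is a bit string, and every bit string describes a derivation: bit 0 rotates
    the list of computed elements, bit 1 moreover supplies the rotated element as the next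
    argument of the current operation, whose value is appended once its arguments are
    complete; the operations take turns cyclically.  The verifier runs this derivation at each of the
    [3 n^2] coordinates.  It is written in a language of queue programs whose loops
    are repeated exactly as many times as the input has symbols, so that polynomial time
    is automatic, and queues are simulated by the tracks of a one-tape machine. *)

Require Import Defs.
From mathcomp Require Import all_boot zify.
From Stdlib Require Import FunctionalExtensionality Classical.
Set Implicit Arguments. Unset Strict Implicit. Unset Printing Implicit Defensive.

(** * A language of queue programs and its automata *)

(* [None] is the mark between the input and the certificate; it also serves as the
   sentinel of loop counters. *)
Definition sym := option bool.
Definition store := nat -> seq sym.
Definition upd (s : store) j q : store := fun i => if i == j then q else s i.

Inductive cmd :=
| Skip
| Push of nat & sym
| Pop of nat & cmd & cmd & cmd
| Then of cmd & cmd
| Rep of cmd.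

(** An empty queue and the mark lead to the same branch [cN]. A loop body that starts with a [Pop]
    and does nothing in that branch idles once its register is empty, so surplus repetitions do no
    harm. *)
Fixpoint eval B c (s : store) : store :=
  match c with
  | Skip => s
  | Push j a => upd s j (rcons (s j) a)
  | Pop j cN cF cT =>
      let s' := upd s j (behead (s j)) in
      match ohead (s j) with
      | Some (Some true) => eval B cT s'
      | Some (Some false) => eval B cF s'
      | _ => eval B cN s'
      end
  | Then a b => eval B b (eval B a s)
  | Rep a => iter B (eval B a) s
  end.

Fixpoint height c :=
  match c with
  | Skip | Push _ _ => 0
  | Pop _ a b d => maxn (height a) (maxn (height b) (height d))
  | Then a b => maxn (height a) (height b)
  | Rep a => (height a).+1
  end.

(** Each round of a loop pays two instructions for rotating a tick; the final 2 pays for pushing and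
    removing the sentinel. *)
Fixpoint bound B c :=
  match c with
  | Skip | Push _ _ => 1
  | Pop _ a b d => (bound B a + bound B b + bound B d).+1
  | Then a b => bound B a + bound B b
  | Rep a => B * (bound B a).+2 + 2
  end.

Fixpoint registers_below K c :=
  match c with
  | Skip => true
  | Push j _ => j < K
  | Pop j a b d => [&& j < K, registers_below K a, registers_below K b & registers_below K d]
  | Then a b => registers_below K a && registers_below K b
  | Rep a => registers_below K a
  end.

(** A loop has three control points of its own: [None] pushes the sentinel, [Some false] pops the
    counter, [Some true] puts the popped tick back. *)
Fixpoint pos c : finType :=
  match c with
  | Skip | Push _ _ => unit : finType
  | Pop _ a b d => option (pos a + (pos b + pos d))%type : finType
  | Then a b => (pos a + pos b)%type : finType
  | Rep a => (option bool + pos a)%type : finType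
  end.

Inductive instr := Nop | IPush of nat & sym | IPop of nat.

Fixpoint entry c : pos c :=
  match c return pos c with
  | Skip | Push _ _ => tt
  | Pop _ _ _ _ => None
  | Then a _ => inl (entry a)
  | Rep _ => inl None
  end.

Section Automaton.
Variable K : nat.

(* A loop whose body has height [h] counts with register [K + h]: its [B] ticks are rotated
   once, and the sentinel shows when the rotation is complete. *)
Fixpoint instr_at c : pos c -> instr :=
  match c return pos c -> instr with
  | Skip => fun _ => Nop
  | Push j a => fun _ => IPush j a
  | Pop j a b d => fun p =>
      match p with
      | None => IPop j
      | Some (inl p) => instr_at p
      | Some (inr (inl p)) => instr_at p
      | Some (inr (inr p)) => instr_at p
      end
  | Then a b => fun p => match p with inl p => instr_at p | inr p => instr_at p end
  | Rep a => fun p =>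
      match p with
      | inl None => IPush (K + height a) None
      | inl (Some false) => IPop (K + height a)
      | inl (Some true) => IPush (K + height a) (Some true)
      | inr p => instr_at p
      end
  end.

Fixpoint next_pos c : pos c -> option sym -> option (pos c) :=
  match c return pos c -> option sym -> option (pos c) with
  | Skip | Push _ _ => fun _ _ => None
  | Pop j a b d => fun p r =>
      match p with
      | None => Some (Some (match r with
                      | Some (Some true) => inr (inr (entry d))
                      | Some (Some false) => inr (inl (entry b))
                      | _ => inl (entry a) end))
      | Some (inl p) => omap (fun p => Some (inl p)) (next_pos p r)
      | Some (inr (inl p)) => omap (fun p => Some (inr (inl p))) (next_pos p r)
      | Some (inr (inr p)) => omap (fun p => Some (inr (inr p))) (next_pos p r)
      end
  | Then a b => fun p r =>
      match p with
      | inl p => Some (if next_pos p r is Some p' then inl p' else inr (entry b))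
      | inr p => omap inr (next_pos p r)
      end
  | Rep a => fun p r =>
      match p with
      | inl None => Some (inl (Some false))
      | inl (Some false) => if r is Some (Some _) then Some (inl (Some true)) else None
      | inl (Some true) => Some (inr (entry a))
      | inr p => Some (if next_pos p r is Some p' then inr p' else inl (Some false))
      end
  end.

Definition effect i (s : store) : store :=
  match i with
  | Nop => s
  | IPush j a => upd s j (rcons (s j) a)
  | IPop j => upd s j (behead (s j))
  end.

Definition answer i (s : store) : option sym := if i is IPop j then ohead (s j) else None.

Inductive run c : pos c -> store -> nat -> store -> Prop :=
| run_exit p s : next_pos p (answer (instr_at p) s) = None -> run p s 1 (effect (instr_at p) s)
| run_step p p' s t s' : next_pos p (answer (instr_at p) s) = Some p' ->
    run p' (effect (instr_at p) s) t s' -> run p s t.+1 s'.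

(* Transfer of a run along an embedding of automata; the exit of the small one
   becomes the state [out] of the large one, or its exit. *)
Lemma run_embed a b (f : pos a -> pos b) (out : option (pos b)) :
  (forall p, instr_at (f p) = instr_at p) ->
  (forall p r, next_pos (f p) r = if next_pos p r is Some p' then Some (f p') else out) ->
  forall p s t s', run p s t s' ->
  if out is Some q then forall t' s'', run q s' t' s'' -> run (f p) s (t + t') s''
  else run (f p) s t s'.
Proof.
move=> cE nE p s t s'; elim=> {p s t s'} [p s E|p p' s t s' E _]; case: out nE => [q|] nE.
- move=> t' s'' R; apply: (@run_step _ _ q); rewrite cE ?nE ?E //.
- by rewrite -cE; apply: run_exit; rewrite nE cE E.
- by move=> IH t' s'' R; apply: (@run_step _ _ (f p')); rewrite cE ?nE ?E //; apply: IH.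
- by move=> IH; apply: (@run_step _ _ (f p')); rewrite cE ?nE ?E.
Qed.

Lemma run_embed_exit a b (f : pos a -> pos b) p s t s' :
  (forall p, instr_at (f p) = instr_at p) ->
  (forall p r, next_pos (f p) r = if next_pos p r is Some p' then Some (f p') else None) ->
  run p s t s' -> run (f p) s t s'.
Proof. by move=> cE nE; apply: (run_embed (out := None) cE nE). Qed.

Lemma run_embed_next a b (f : pos a -> pos b) q p s t s' t' s'' :
  (forall p, instr_at (f p) = instr_at p) ->
  (forall p r, next_pos (f p) r = if next_pos p r is Some p' then Some (f p') else Some q) ->
  run p s t s' -> run q s' t' s'' -> run (f p) s (t + t') s''.
Proof. by move=> cE nE R; apply: (run_embed (out := Some q) cE nE). Qed.

(** Allows the momentary content of a counter to be ignored while the loop body is evaluated. *)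
Lemma eval_counter B c s i q : registers_below K c -> K <= i ->
  eval B c (upd s i q) = upd (eval B c s) i q.
Proof.
have updC j u v (x : store) : j != i -> upd (upd x i u) j v = upd (upd x j v) i u.
  move=> ne; apply: functional_extensionality => k; rewrite /upd.
  by case: (k =P j) => // ->; rewrite (negPf ne).
elim: c s => [|j a|j a IHa b IHb d IHd|a IHa b IHb|a IHa] s //= wf le_i.
- have ne : j != i by rewrite neq_ltn (leq_trans wf le_i).
  by rewrite updC // /upd (negPf ne).
- case/and4P: wf => lj wa wb wd.
  have ne : j != i by rewrite neq_ltn (leq_trans lj le_i).
  have -> : upd s i q j = s j by rewrite /upd (negPf ne).
  by case: (ohead _) => [[[]|]|]; rewrite updC // ?IHa ?IHb ?IHd.
- by case/andP: wf => wa wb; rewrite IHa ?IHb.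
- suff G n : iter n (eval B a) (upd s i q) = upd (iter n (eval B a) s) i q by exact: G.
  by elim: n => //= n ->; rewrite IHa.
Qed.

Lemma upd_id (s : store) i : upd s i (s i) = s.
Proof. by apply: functional_extensionality => k; rewrite /upd; case: eqP => [->|]. Qed.

Lemma upd_upd (s : store) i q q' : upd (upd s i q) i q' = upd s i q'.
Proof. by apply: functional_extensionality => k; rewrite /upd; case: eqP. Qed.

Lemma updE (s : store) i q : upd s i q i = q.
Proof. by rewrite /upd eqxx. Qed.

Lemma eval_counter_id B c s i : registers_below K c -> K <= i -> eval B c s i = s i.
Proof. by move=> wf le_i; rewrite -{1}(upd_id s i) eval_counter // updE. Qed.

Definition tick : sym := Some true.

(** Induction on the program: the counters that a subprogram needs are full when it starts, and a
    complete rotation brings all ticks back. *)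
Lemma run_eval B c s : registers_below K c ->
  (forall i, K <= i -> i < K + height c -> s i = nseq B tick) ->
  exists2 t, t <= bound B c & run (entry c) s t (eval B c s).
Proof.
elim: c s => [|j a|j a IHa b IHb d IHd|a IHa b IHb|a IHa] s /= wf cnt.
- by exists 1 => //; exact: (@run_exit Skip tt s).
- by exists 1 => //; exact: (@run_exit (Push j a) tt s).
- case/and4P: wf => lj wa wb wd.
  pose s' := upd s j (behead (s j)).
  have cnt' i : K <= i -> i < K + maxn (height a) (maxn (height b) (height d)) -> s' i = nseq B tick.
    move=> Ki lti; rewrite /s' /upd; case: eqP => [E|_]; last exact: cnt.
    by rewrite E leqNgt lj in Ki.
  have wid h : h <= maxn (height a) (maxn (height b) (height d)) ->
     forall i, K <= i -> i < K + h -> s' i = nseq B tick.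
    by move=> le i Ki lti; apply: cnt' => //; apply: leq_trans lti _; rewrite leq_add2l.
  have [|ta la Ra] := IHa s' wa; first by apply: wid; rewrite leq_maxl.
  have [|tb lb Rb] := IHb s' wb; first by apply: wid; rewrite !leq_max leqnn orbT.
  have [|td ld Rd] := IHd s' wd; first by apply: wid; rewrite !leq_max leqnn !orbT.
  have fin p t x : next_pos (None : pos (Pop j a b d)) (ohead (s j)) = Some p ->
      t <= bound B a + bound B b + bound B d -> @run (Pop j a b d) p s' t x ->
     exists2 t, t <= (bound B a + bound B b + bound B d).+1 & @run (Pop j a b d) None s t x.
    by move=> E lt R; exists t.+1 => //; apply: run_step E R.
  have GA : @run (Pop j a b d) (Some (inl (entry a))) s' ta (eval B a s').
    apply: (run_embed_exit (f := fun p => Some (inl p) : pos (Pop j a b d))) Ra => // p r.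
  have GB : @run (Pop j a b d) (Some (inr (inl (entry b)))) s' tb (eval B b s').
    apply: (run_embed_exit (f := fun p => Some (inr (inl p)) : pos (Pop j a b d))) Rb => // p r.
  have GD : @run (Pop j a b d) (Some (inr (inr (entry d)))) s' td (eval B d s').
    apply: (run_embed_exit (f := fun p => Some (inr (inr p)) : pos (Pop j a b d))) Rd => // p r.
  rewrite -/s'; case E: (ohead (s j)) fin => [[[]|]|] fin.
  + by apply: fin GD => //; apply: leq_trans ld _; rewrite leq_addl.
  + by apply: fin GB => //; apply: leq_trans lb _; rewrite -addnA addnCA leq_addr.
  + by apply: fin GA => //; apply: leq_trans la _; rewrite -addnA leq_addr.
  + by apply: fin GA => //; apply: leq_trans la _; rewrite -addnA leq_addr.
- case/andP: wf => wa wb.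
  have [|ta la Ra] := IHa s wa.
    by move=> i Ki lti; apply: cnt => //; apply: leq_trans lti _; rewrite leq_add2l leq_maxl.
  have [|tb lb Rb] := IHb (eval B a s) wb.
    move=> i Ki lti; rewrite eval_counter_id //.
    by apply: cnt => //; apply: leq_trans lti _; rewrite leq_add2l leq_maxr.
  exists (ta + tb); first exact: leq_add.
  have := run_embed_exit (f := inr : pos b -> pos (Then a b)) (fun _ => erefl) (fun _ _ => erefl) Rb.
  apply: (run_embed_next (f := inl : pos a -> pos (Then a b))) Ra => // p r /=.
  by case: (next_pos p r).
(* With [n] rounds to go the counter shows [n] ticks, the sentinel, and then the ticks already
   rotated. *)
- pose l := K + height a; pose q n := rcons (nseq n tick) None ++ nseq (B - n) tick.
  have lK : K <= l by rewrite leq_addr.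
  have sl : s l = nseq B tick by apply: cnt; rewrite // addnS.
  have loop n x : n <= B -> (forall i, K <= i -> i < l -> x i = nseq B tick) ->
     x l = nseq B tick ->
     exists2 t, t <= n * (bound B a).+2 + 1 &
       @run (Rep a) (inl (Some false)) (upd x l (q n)) t (iter n (eval B a) x).
    elim: n x => [|n IHn] x le_n cx xl.
      exists 1 => //=.
      have E : x = effect (@instr_at (Rep a) (inl (Some false))) (upd x l (q 0)).
        by rewrite /= updE upd_upd /q /= subn0 -xl upd_id.
      by rewrite {2}E; apply: run_exit; rewrite /= updE.
    pose y := upd x l (rcons (nseq n tick ++ None :: nseq (B - n.+1) tick) tick).
    have qE : nseq n tick ++ None :: nseq (B - n.+1) tick = rcons (nseq n tick) None ++ nseq (B - n.+1) tick.
      by rewrite cat_rcons.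
    have yE : y = upd x l (q n).
      congr upd; rewrite qE /q rcons_cat; congr cat.
      by rewrite -[B - n](@subnK 1) ?subn_gt0 // nseqD cats1 -subnDA addn1.
    have [|t lt R] := IHa y wf.
      by move=> i Ki lti; rewrite /y /upd; case: eqP => [E|_]; rewrite ?cx //; rewrite E ltnn in lti.
    have [||| t' lt' R'] := IHn (eval B a x).
    + exact: ltnW.
    + by move=> i Ki lti; rewrite eval_counter_id // cx.
    + by rewrite eval_counter_id.
    exists (t + t').+2.
      rewrite mulSn -addnA addSn addSn !ltnS; exact: leq_add.
    apply: (@run_step (Rep a) _ (inl (Some true))); first by rewrite /= updE /q rcons_cons.
    apply: (@run_step (Rep a) _ (inr (entry a))) => //.
    have -> : effect (@instr_at (Rep a) (inl (Some true))) (effect (@instr_at (Rep a) (inl (Some false))) (upd x l (q n.+1))) = y.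
      by rewrite /= !updE !upd_upd /y /q -/nseq qE.
    rewrite iterSr.
    apply: (run_embed_next (f := inr : pos a -> pos (Rep a))) R _ => // [p r|] /=.
      by case: (next_pos p r).
    by move: R'; rewrite yE eval_counter.
  have [||| t lt R] := loop B s => //.
    by move=> i Ki lti; apply: cnt => //; rewrite addnS ltnS ltnW.
  exists t.+1; first by rewrite addn2 ltnS -addn1.
  apply: (@run_step (Rep a) _ (inl (Some false))) => //=.
  by rewrite -/l sl; move: R; rewrite /q subnn cats0.
Qed.

End Automaton.

(** * Simulation by a Turing machine with one track per queue *)

Section Tapes.
Variable M : TM.

(** Cells are numbered from the initial head position. A left move out of cell 0 would shift this
    numbering, hence the side condition of [reach1]. *)
Definition on_tape (cf : config M) q (f : nat -> tm_sym M) p : Prop :=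
  let: (q0, l, h, r) := cf in
  [/\ q0 = q, size l = p & forall i, nth (tm_emb M Blank) (rev l ++ h :: r) i = f i].

Definition reach q f p t q' f' p' : Prop :=
  forall cf : config M, on_tape cf q f p -> on_tape (iter t (@tm_step M) cf) q' f' p'.

Definition write (f : nat -> tm_sym M) p x : nat -> tm_sym M := fun i => if i == p then x else f i.

Lemma reach_trans q f p t q1 f1 p1 t' q2 f2 p2 :
  reach q f p t q1 f1 p1 -> reach q1 f1 p1 t' q2 f2 p2 -> reach q f p (t + t') q2 f2 p2.
Proof. by move=> H H' cf /H /H'; rewrite addnC iterD. Qed.

Lemma reach0 q f p : reach q f p 0 q f p.
Proof. by []. Qed.

Lemma reach1 q f p q' x mv : tm_delta q (f p) = (q', x, mv) ->
  (mv = MoveL -> 0 < p) ->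
  reach q f p 1 q' (write f p x) (match mv with MoveL => p.-1 | MoveR => p.+1 | Stay => p end).
Proof.
move=> dE mvL [[[q0 l] h] r] [-> sl fE]; rewrite -{p}sl in dE mvL *.
have {}dE : tm_delta q h = (q', x, mv).
  by rewrite -dE -fE nth_cat size_rev ltnn subnn.
have wE i : nth (tm_emb M Blank) (rev l ++ x :: r) i = write f (size l) x i.
  rewrite /write -fE !nth_cat size_rev; case: ltngtP => // [lt|->]; last by rewrite subnn.
  by rewrite -[i - _]prednK ?subn_gt0.
rewrite /= dE; case: mv mvL {dE} => [/(_ erefl) l0|_|_]; split => //=.
- by rewrite size_behead.
- move=> i; rewrite -wE; case: l l0 {fE wE} => //= a l _.
  by rewrite rev_cons cat_rcons.
- move=> i; rewrite -wE rev_cons cat_rcons.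
  case: r {fE wE} => [|b r] //=; rewrite !nth_cat; case: ltnP => // le.
  by case: (i - _) => [|[|k]] //=; rewrite nth_nil.
Qed.

End Tapes.

Section Machine.
Variables (K : nat) (c : cmd) (bad : nat).
Let R := K + height c.
(* The flag marks the leftmost cell; the other component holds one symbol of each queue. *)
Definition cell : finType := (bool * {ffun 'I_R.+1 -> option sym})%type : finType.

Definition get (x : cell) j : option sym := x.2 (inord j).
Definition put (x : cell) j v : cell := (x.1, [ffun i => if i == inord j then v else x.2 i]).

(** Besides its symbol on track 0, an input cell carries a tick on every track from [K] on. The
    counters are thus full from the start, and [B] is the number of nonblank cells, mark
    included. *)
Definition emb_cell (s : isym) : cell :=
  (false, match s with
          | Blank => [ffun => None]
          | _ => [ffun j : 'I_R.+1 => if val j == 0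
                    then Some (match s with Bit0 => Some false | Bit1 => Some true | _ => None end)
                    else if K <= j then Some tick else None]
          end).

(** [going p] walks right along the queue addressed at [p]; [shifting p v] sweeps left, [v] being
    what the current cell has to receive; [returning] walks back to cell 0. *)
Definition tstate : finType :=
  ((pos c * option (option sym)) + (option (pos c) + (bool * bool)))%type : finType.

Definition going p : tstate := inl (p, None).
Definition shifting p v : tstate := inl (p, Some v).
Definition returning o : tstate := inr (inl o).
Definition start0 : tstate := inr (inr (false, false)).
Definition start1 : tstate := inr (inr (false, true)).
Definition rejecting : tstate := inr (inr (true, false)).
Definition accepting : tstate := inr (inr (true, true)).

(* [start1] looks at the second input symbol: it is [false] iff the universe has one element.
   That case is accepted at once, since unary arities then make the input much longer
   than the size of the algebra. *)
Definition tdelta (q : tstate) (x : cell) : tstate * cell * move :=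
  match q with
  | inl (p, None) =>
      match instr_at K p with
      | Nop => (returning (next_pos p None), x, Stay)
      | IPush j a => if get x j is None then (returning (next_pos p None), put x j (Some a), Stay)
                     else (q, x, MoveR)
      | IPop j => if get x j is None then
                    if x.1 then (returning (next_pos p None), x, Stay) else (shifting p None, x, MoveL)
                  else (q, x, MoveR)
      end
  | inl (p, Some v) =>
      if instr_at K p is IPop j then
        if x.1 then (returning (next_pos p (get x j)), put x j v, Stay)
        else (shifting p (get x j), put x j v, MoveL)
      else (q, x, Stay)
  | inr (inl o) =>
      if x.1 then
        (if o is Some p then going p else if get x bad is None then accepting else rejecting, x, Stay)
      else (q, x, MoveL)
  | inr (inr (false, false)) => (start1, (true, x.2), MoveR)
  | inr (inr (false, true)) =>
      if get x 0 is Some (Some false) then (accepting, x, Stay) else (going (entry c), x, MoveL)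
  | inr (inr (true, _)) => (q, x, Stay)
  end.

Definition machine : TM :=
  {| tm_state := tstate; tm_sym := cell; tm_emb := emb_cell; tm_start := start0;
     tm_accept := accepting; tm_delta := tdelta |}.

Definition tape (s : store) i : cell := (i == 0, [ffun j : 'I_R.+1 => onth (s j) i]).

Lemma get_tape s i j : j < R.+1 -> get (tape s i) j = onth (s j) i.
Proof. by move=> lt; rewrite /get ffunE inordK. Qed.

Notation reachM := (@reach machine).

Lemma write_same (f : nat -> cell) p : @write machine f p (f p) = f.
Proof. by apply: functional_extensionality => i; rewrite /write; case: eqP => [->|]. Qed.

Lemma reach_return o s p : reachM (returning o) (tape s) p p (returning o) (tape s) 0.
Proof.
elim: p => [|p IH]; first exact: reach0.
rewrite -add1n; apply: reach_trans IH.
by have := @reach1 machine (returning o) (tape s) p.+1 _ _ _ erefl (fun=> isT); rewrite write_same.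
Qed.

Lemma reach_going p s j n : j < R.+1 ->
  (forall x, get x j <> None -> tdelta (going p) x = (going p, x, MoveR)) -> n <= size (s j) ->
  reachM (going p) (tape s) 0 n (going p) (tape s) n.
Proof.
move=> lj dE; elim: n => [|n IH] ln; first exact: reach0.
rewrite -addn1; apply: reach_trans (IH (ltnW ln)) _.
have E : tdelta (going p) (tape s n) = (going p, tape s n, MoveR).
  by apply: dE; rewrite get_tape // => E; have := onthTE (s j) n; rewrite E ln.
by have := @reach1 machine _ _ _ _ _ _ E; rewrite write_same addn1; apply.
Qed.

Definition below_R i := match i with Nop => true | IPush j _ => j < R | IPop j => j < R end.

(** One journey to the end of the queue and back: a push writes in the first free cell, a pop shifts
    the queue by one cell on the way back. *)
Lemma reach_step p s L : below_R (instr_at K p) -> (forall j, j < R -> size (s j) <= L) ->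
  exists2 t, t <= 2 * L + 1 &
  reachM (going p) (tape s) 0 t
    (returning (next_pos p (answer (instr_at K p) s))) (tape (effect (instr_at K p) s)) 0.
Proof.
move=> jR sL.
case E: (instr_at K p) jR => [|j a|j] /= jR.
- exists 1; first by rewrite addn1.
  have := @reach1 machine (going p) (tape s) 0; rewrite /= E => /(_ _ _ _ erefl).
  by rewrite write_same; apply.
- pose n := size (s j); have jR' : j < R.+1 by rewrite ltnS ltnW.
  exists (n + (1 + n)); first by rewrite mul2n -addnn addnCA addnC leq_add2r leq_add ?sL.
  have goR x : get x j <> None -> tdelta (going p) x = (going p, x, MoveR).
    by rewrite /= E; case: (get x j).
  apply: (@reach_trans machine _ _ _ _ _ _ _ _ _ _ _ (reach_going jR' goR (leqnn n))).
  apply: (reach_trans _ (@reach_return _ _ n)).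
  have D : tdelta (going p) (tape s n) = (returning (next_pos p None), put (tape s n) j (Some a), Stay).
    by rewrite /= E get_tape // onth_default.
  have := @reach1 machine _ _ _ _ _ _ D.
  suff -> : @write machine (tape s) n (put (tape s n) j (Some a)) = tape (upd s j (rcons (s j) a)) by apply.
  apply: functional_extensionality => i; rewrite /write.
  case: (i =P n) => [->|ne]; congr pair; apply/ffunP => k; rewrite !ffunE /upd -?val_eqE /= ?inordK //.
    by case: eqP => // _; rewrite -cats1 onth_cat ltnn subnn.
  case: eqP => // ->; rewrite -cats1 onth_cat; case: ltngtP ne => // gt _.
  by rewrite (onth_default (ltnW gt)) onth_default //= subn_gt0.
- have jR' : j < R.+1 by rewrite ltnS ltnW.
  have goR : forall x, get x j <> None -> tdelta (going p) x = (going p, x, MoveR).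
    by move=> x; rewrite /= E; case: (get x j).
  case Q: (s j) => [|a q] /=.
    exists 1; first by rewrite addn1.
    have D : tdelta (going p) (tape s 0) = (returning (next_pos p None), tape s 0, Stay).
      by rewrite /= E get_tape // Q.
    have := @reach1 machine _ _ _ _ _ _ D; rewrite write_same.
    have -> : upd s j [::] = s by rewrite -Q upd_id.
    by apply.
  pose n := size q.
  (* In [g m] the cells from [m] on already hold the shifted queue, those before [m] the old one. *)
  pose g m i : cell := ((i == 0), [ffun k : 'I_R.+1 => if val k == j then
            if i < m then onth (a :: q) i else onth q i else onth (s k) i]).
  have sweep m : m <= n -> reachM (shifting p (onth q m)) (g m.+1) m m.+1
      (returning (next_pos p (Some a))) (g 0) 0.
    elim: m => [|m IH] lm.
      have D : tdelta (shifting p (onth q 0)) (g 1 0) =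
         (returning (next_pos p (Some a)), put (g 1 0) j (onth q 0), Stay).
        by rewrite /= E /get /g ffunE /= inordK // eqxx.
      have := @reach1 machine _ _ _ _ _ _ D.
      suff -> : @write machine (g 1) 0 (put (g 1 0) j (onth q 0)) = g 0 by apply.
      apply: functional_extensionality => i; rewrite /write.
      case: (i =P 0) => [->|ne]; congr pair; apply/ffunP => k; rewrite !ffunE -?val_eqE /= ?inordK //.
        by case: eqP.
      by case: i ne.
    have D : tdelta (shifting p (onth q m.+1)) (g m.+2 m.+1) =
         (shifting p (onth q m), put (g m.+2 m.+1) j (onth q m.+1), MoveL).
      by rewrite /= E /get /g ffunE /= inordK // eqxx ltnSn.
    apply: (@reach_trans machine _ _ _ 1 _ _ _ m.+1 _ _ _ _ (IH (ltnW lm))).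
    have := @reach1 machine _ _ _ _ _ _ D (fun=> isT).
    suff -> : @write machine (g m.+2) m.+1 (put (g m.+2 m.+1) j (onth q m.+1)) = g m.+1 by [].
    apply: functional_extensionality => i; rewrite /write.
    case: (i =P m.+1) => [->|/eqP ne]; congr pair; apply/ffunP => k; rewrite !ffunE -?val_eqE /= ?inordK //.
      by case: eqP => //; rewrite ltnn.
    by rewrite (ltnS i m.+1) (leq_eqVlt i) (negPf ne).
  exists (n.+1 + (1 + n.+1)).
    have := sL _ jR; rewrite Q /= -/n => le.
    by rewrite mul2n -addnn addnCA addnC leq_add2r leq_add.
  have ln : n.+1 <= size (s j) by rewrite Q.
  apply: reach_trans (reach_going jR' goR ln) _.
  have D : tdelta (going p) (tape s n.+1) = (shifting p None, tape s n.+1, MoveL).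
    by rewrite /= E get_tape // Q onth_default.
  have := @reach1 machine _ _ _ _ _ _ D (fun=> isT); rewrite write_same => H1.
  apply: reach_trans H1 _.
  have := sweep n (leqnn _); rewrite (onth_default (leqnn _)).
  have -> : g n.+1 = tape s.
    apply: functional_extensionality => i; congr pair; apply/ffunP => k; rewrite !ffunE /=.
    case: eqP => // ->; rewrite Q; case: ltnP => // le; rewrite !onth_default //.
    exact: ltnW.
  suff -> : tape (upd s j q) = g 0 by [].
  apply: functional_extensionality => i; congr pair; apply/ffunP => k; rewrite !ffunE /= /upd.
  by case: eqP.
Qed.

Lemma reach_return_step o s :
  reachM (returning o) (tape s) 0 1
    (if o is Some p then going p else if get (tape s 0) bad is None then accepting else rejecting)
    (tape s) 0.
Proof.
by have := @reach1 machine (returning o) (tape s) 0 _ _ _ erefl; rewrite write_same; apply.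
Qed.

Definition verdict s := if get (tape s 0) bad is None then accepting else rejecting.

Lemma size_effect i (s : store) j : size (effect i s j) <= (size (s j)).+1.
Proof.
case: i => [|k a|k] //=; rewrite /upd; case: eqP => // ->.
  by rewrite size_rcons.
by rewrite size_behead; apply: leq_trans (leq_pred _) _.
Qed.

Hypothesis below : forall p : pos c, below_R (instr_at K p).

(** A queue grows by at most one symbol per instruction, so all queues keep length at most
    [L + t]. *)
Lemma reach_run p s t s' L : run K p s t s' -> (forall j, j < R -> size (s j) <= L) ->
  exists2 T, T <= t * (2 * (L + t) + 2) &
  reachM (going p) (tape s) 0 T (verdict s') (tape s') 0.
Proof.
move=> r; elim: r L => {p s t s'} [p s E|p p' s t s' E _ IH] L sL.
  have [t lt H] := reach_step (below p) sL.
  exists (t + 1); last first.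
    by apply: reach_trans H _; rewrite E; apply: reach_return_step.
  by lia.
have [t1 lt1 H] := reach_step (below p) sL.
have [|t2 lt2 H2] := IH L.+1.
  by move=> j jR; apply: leq_trans (size_effect _ _ _) _; rewrite ltnS sL.
exists (t1 + (1 + t2)).
  by rewrite mulSn -addSnnS; lia.
apply: reach_trans H _; rewrite E; apply: reach_trans (_ : reachM _ _ _ 1 _ _ _) H2.
exact: reach_return_step.
Qed.

Lemma halted q (cf : config machine) t : cf.1.1.1 = q -> (q = accepting \/ q = rejecting) ->
  (iter t (@tm_step machine) cf).1.1.1 = q.
Proof.
move=> E H; elim: t => //= t; case: (iter _ _ _) => [[[q0 l] h] r] /= ->.
by case: H => ->.
Qed.

End Machine.

Lemma pos_below K c (p : pos c) : registers_below K c -> below_R K c (instr_at K p).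
Proof.
have mono a b i : height a <= height b -> below_R K a i -> below_R K b i.
  by case: i => //= [j _|j] le lt; apply: leq_trans lt _; rewrite leq_add2l.
elim: c p => [|j a|j a IHa b IHb d IHd|a IHa b IHb|a IHa] //=.
- by move=> _ lt; apply: leq_trans lt _; rewrite leq_addr.
- case=> [[p|[p|p]]|] /and4P[lj wa wb wd] /=.
  + by apply: mono (IHa p wa); rewrite leq_maxl.
  + by apply: mono (IHb p wb); rewrite !leq_max leqnn orbT.
  + by apply: mono (IHd p wd); rewrite !leq_max leqnn !orbT.
  + by apply: leq_trans lj _; rewrite leq_addr.
- case=> p /andP[wa wb].
  + by apply: mono (IHa p wa); rewrite leq_maxl.
  + by apply: mono (IHb p wb); rewrite leq_maxr.
- case=> [[[]|]|p] wa /=; rewrite ?ltn_add2l //.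
  by apply: mono (IHa p wa).
Qed.

(** * The machine on an encoded input *)

Definition init_store K (w cert : seq bool) : store := fun j =>
  if j == 0 then map Some w ++ None :: map Some cert
  else if j < K then [::] else nseq (size w + (size cert).+1) tick.

Section Spec.
Variables (K : nat) (c : cmd) (bad : nat) (w' cert : seq bool) (b : bool).
Hypotheses (K_gt0 : 0 < K) (wf : registers_below K c) (bad_lt : bad < K).
Let w := true :: b :: w'.
Let M := machine K c bad.
Let B := size w + (size cert).+1.

(** The initial tape lacks only the flag of cell 0, which the first transition writes. *)
Lemma start_reach : exists f,
  [/\ on_tape (tm_init M w cert) (start0 c) f 0, get (f 1) 0 = Some (Some b)
    & write (M := M) f 0 (true, (f 0).2) = tape K c (init_store K w cert)].
Proof.
pose tp := [seq emb_cell K c s | s <- map of_bool w ++ Mark :: map of_bool cert].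
exists (nth (emb_cell K c Blank) tp); split => //.
  by rewrite /get /tp /=; case: (b); rewrite ffunE inordK.
apply: functional_extensionality => i; rewrite /write.
have embE j (s : isym) : s <> Blank -> (emb_cell K c s).2 j = if val j == 0
    then Some (match s with Bit0 => Some false | Bit1 => Some true | _ => None end)
    else if K <= j then Some tick else None by case: s => //; rewrite ffunE.
have tpE j : (nth (emb_cell K c Blank) tp i).2 j = onth (init_store K w cert (val j)) i.
  have sz : size tp = B by rewrite size_map size_cat /= !size_map.
  case: (ltnP i B) => [lt|ge]; last first.
    rewrite nth_default ?sz // ffunE onth_default // /init_store; case: eqP => _.
      by rewrite size_cat /= !size_map.
    by case: ifP => // _; rewrite size_nseq.
  have lt' : i < size (map of_bool w ++ Mark :: map of_bool cert) by move: lt; rewrite -sz size_map.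
  have nb : nth Mark (map of_bool w ++ Mark :: map of_bool cert) i <> Blank.
    rewrite nth_cat; case: ltnP => [lw|_].
      by rewrite size_map in lw; rewrite (nth_map true) //; case: nth.
    case: (i - _) => //= n; elim: cert n {tp sz lt lt'} => [|[] l IH] [|n] //=; exact: IH.
  rewrite (nth_map Mark) // embE // /init_store; case: eqP => _.
    rewrite nth_cat onth_cat !size_map; case: ltnP => [lw|ge].
      by rewrite (nth_map true) // onthE (nth_map (Some true)) ?size_map // (nth_map true) //; case: nth.
    have: i - size w < (size cert).+1 by rewrite ltn_subLR.
    case: (i - _) => //= n; rewrite ltnS => ln.
    by rewrite (nth_map true) // onthE (nth_map (Some true)) ?size_map // (nth_map true) //; case: nth.
  by rewrite leqNgt; case: (ltnP j K) => _; rewrite ?onth0n // onth_nseq lt.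
have flag : (nth (emb_cell K c Blank) tp i).1 = false.
  by rewrite /tp; elim: (_ ++ _) {tpE} i => [|x l IH] [|k] //=.
rewrite /tape; case: eqP => [i0|/eqP/negPf ne].
- by rewrite -i0; congr pair; apply/ffunP => j; rewrite ffunE tpE.
- rewrite -ne in flag *; rewrite [LHS]surjective_pairing flag; congr pair.
  by apply/ffunP => j; rewrite ffunE tpE.
Qed.

Lemma start1_reach :
  on_tape (iter 1 (@tm_step M) (tm_init M w cert)) (start1 c) (tape K c (init_store K w cert)) 1 /\
  get (tape K c (init_store K w cert) 1) 0 = Some (Some b).
Proof.
have [f [init f1 fE]] := start_reach; split; last by rewrite -fE -f1.
by have := @reach1 M (start0 c) f 0 _ _ _ erefl; rewrite fE; apply.
Qed.

Lemma accepts_short : b = false -> tm_accepts_within M w cert 2.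
Proof.
move=> b0; have [H g] := start1_reach; exists 2; split => //.
have D : tdelta bad (start1 c) (tape K c (init_store K w cert) 1) =
   (accepting c, tape K c (init_store K w cert) 1, Stay) by rewrite /= g b0.
have := @reach1 M _ _ _ _ _ _ D _ _ H.
by rewrite -iterD; move: (iter _ _ _) => [[[q l] h] r] /= /(_ (fun=> isT)) [].
Qed.

(** Queue programs always terminate, so every certificate receives a verdict in time. The two extra
    steps are those of the start states. *)
Lemma machine_halts : b = true ->
  exists2 T, T <= bound B c * (2 * (B + bound B c) + 2) + 2 &
  (iter T (@tm_step M) (tm_init M w cert)).1.1.1 =
    if eval B c (init_store K w cert) bad is [::] then accepting c else rejecting c.
Proof.
move=> b1; have [H g] := start1_reach.
have D : tdelta bad (start1 c) (tape K c (init_store K w cert) 1) =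
   (going (entry c), tape K c (init_store K w cert) 1, MoveL) by rewrite /= g b1.
have := @reach1 M _ _ _ _ _ _ D (fun=> isT); rewrite write_same => {}D.
have [|t lt R] := @run_eval K B c (init_store K w cert) wf.
  by move=> i Ki _; rewrite /init_store ltnNge Ki; case: eqP Ki => // ->; rewrite leqNgt K_gt0.
have sz j : j < K + height c -> size (init_store K w cert j) <= B.
  move=> _; rewrite /init_store; case: eqP => _; first by rewrite size_cat /= !size_map.
  by case: ifP => // _; rewrite size_nseq.
have [T lT H2] := reach_run bad (fun p => pos_below p wf) R sz.
exists (T + 2).
  rewrite leq_add2r (leq_trans lT) //; apply: leq_mul => //.
  by rewrite leq_add2r leq_mul2l leq_add2l lt.
have -> : T + 2 = (1 + T) + 1 by lia.
rewrite iterD; have := reach_trans D H2 H.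
move: (iter _ _ _) => [[[q l] h] r] [-> _ _] /=.
rewrite /verdict get_tape; last by rewrite ltnS ltnW // (leq_trans bad_lt) // leq_addr.
by case: (eval _ _ _ _) => [|[]].
Qed.

Lemma machine_accepts : b = true -> eval B c (init_store K w cert) bad = [::] ->
  tm_accepts_within M w cert (bound B c * (2 * (B + bound B c) + 2) + 2).
Proof. by move=> b1 E; have [T lT] := machine_halts b1; rewrite E => ?; exists T. Qed.

(** The machine also reaches the verdict given by [machine_halts]; both final states being
    absorbing, that verdict cannot be a rejection. *)
Lemma machine_accepts_inv T : b = true -> tm_accepts_within M w cert T ->
  eval B c (init_store K w cert) bad = [::].
Proof.
move=> b1 [t [_ A]]; have [t' _] := machine_halts b1.
case: (eval _ _ _ _) => // x l R.
have := halted t' A (or_introl erefl); rewrite -iterD addnC iterD.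
by rewrite (halted _ R (or_intror erefl)).
Qed.

End Spec.

(** * Specifications of the basic queue programs *)

Notation t1 := (Some true).
Notation f0 := (Some false).
Definition ones n : seq sym := nseq n t1.
Definition num v : seq sym := map Some (unary v).

Lemma num0 : num 0 = [:: f0]. Proof. by []. Qed.
Lemma numS v : num v.+1 = t1 :: num v. Proof. by []. Qed.
Lemma numE v : num v = rcons (ones v) f0. Proof. by rewrite /num /unary map_rcons map_nseq. Qed.
Lemma rcons_ones v : rcons (ones v) t1 = ones v.+1.
Proof. by rewrite /ones -[v.+1]addn1 nseqD cats1. Qed.
Lemma ones_add a b : ones a ++ ones b = ones (a + b).
Proof. by rewrite /ones nseqD. Qed.

Section Rules.
Variable B : nat.

Lemma eval_then a b s : eval B (Then a b) s = eval B b (eval B a s).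
Proof. by []. Qed.

(** [G k] is the store with [k] useful rounds to go; [G 0] is a fixed point of the body and absorbs
    the surplus rounds. *)
Lemma rep_nat (G : nat -> store) body m :
  (forall k, k < m -> eval B body (G k.+1) = G k) -> eval B body (G 0) = G 0 ->
  m <= B -> eval B (Rep body) (G m) = G 0.
Proof.
move=> GS G0 le /=; rewrite -{1}(subnKC le) addnC iterD.
have -> : iter m (eval B body) (G m) = G 0.
  by elim: m GS {le} => // m IH GS; rewrite iterSr GS // IH // => k lt; apply/GS/ltnW.
by elim: (_ - _) => //= n ->.
Qed.

Lemma rep_foldl (A T : Type) (ok : A -> seq T -> Prop) (G : A -> seq T -> store) step body a l :
  (forall a b l, ok a (b :: l) -> eval B body (G a (b :: l)) = G (step a b) l /\ ok (step a b) l) ->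
  (forall a, eval B body (G a [::]) = G a [::]) ->
  ok a l -> size l <= B -> eval B (Rep body) (G a l) = G (foldl step a l) [::].
Proof.
move=> GS G0 okl le /=; rewrite -{1}(subnKC le) addnC iterD.
have -> : iter (size l) (eval B body) (G a l) = G (foldl step a l) [::].
  elim: l a okl {le} => // b l IH a okl; rewrite [size _]/= iterSr.
  by have [-> okl'] := GS _ _ _ okl; rewrite IH.
by elim: (_ - _) => //= n ->.
Qed.

Definition push_all ds s := foldr (fun d c => Then (Push d s) c) Skip ds.
Definition drain a cF cT := Rep (Pop a Skip cF cT).
Definition move a ds := drain a (push_all ds f0) (push_all ds t1).
Definition copy a d t := Then (move a [:: t; d]) (move t [:: a]).
(** Two nested loops remove up to [B * B] symbols; the list of computed elements may be longer than
    [B]. *)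
Definition clear a := Rep (Rep (Pop a Skip Skip Skip)).

(* Transfers one unary number from the front of [q]: register [rF] is nonempty
   until the terminating [false] has been read. *)
Definition transfer rF q ds1 ds0 :=
  Then (Push rF t1)
    (drain rF Skip (Pop q Skip (push_all ds0 f0) (Then (push_all ds1 t1) (Push rF t1)))).

Lemma eval_push_all ds a (s : store) : uniq ds ->
  eval B (push_all ds a) s = fun r => s r ++ nseq (r \in ds) a.
Proof.
elim: ds s => [|d ds IH] s /=; first by move=> _; apply: functional_extensionality => r; rewrite cats0.
case/andP=> dN u; rewrite IH //; apply: functional_extensionality => r; rewrite inE /upd.
by case: eqP => [->|_] //=; rewrite (negPf dN) /= cats0 cats1.
Qed.

Lemma eval_move a ds (s : store) l : uniq ds -> a \notin ds -> s a = map Some l -> size l <= B ->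
  eval B (move a ds) s = fun r => if r == a then [::] else if r \in ds then s r ++ s a else s r.
Proof.
move=> u aN sa sz.
pose G (x : seq bool) (y : seq bool) : store := fun r => if r == a then map Some y else
   if r \in ds then s r ++ map Some x else s r.
have -> : s = G [::] l.
  apply: functional_extensionality => r; rewrite /G; case: eqP => [->//|_]; rewrite cats0.
  by case: ifP.
rewrite (@rep_foldl _ _ (fun _ _ => True) G rcons) //.
- have -> : foldl rcons [::] l = l.
    by rewrite -[RHS]cat0s; elim: l {sa sz} [::] => [|b l IH] x /=; rewrite ?cats0 // IH cat_rcons.
  apply: functional_extensionality => r; rewrite /G eqxx cats0; case: eqP => // _.
  by case: ifP.
- move=> x b y _; split=> //=; rewrite {1}/G eqxx /=.
  have -> : upd (G x (b :: y)) a (behead (G x (b :: y) a)) = G x y.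
    by apply: functional_extensionality => r; rewrite /upd /G !eqxx; case: eqP.
  have E : eval B (push_all ds (Some b)) (G x y) = G (rcons x b) y.
    rewrite eval_push_all //; apply: functional_extensionality => r; rewrite /G.
    case: eqP => [->|_]; first by rewrite (negPf aN) cats0.
    by case: ifP => _; rewrite ?cats0 // -cats1 map_cat catA.
  by case: b E.
- move=> x /=; rewrite {1}/G eqxx /=.
  by apply: functional_extensionality => r; rewrite /upd /G eqxx; case: eqP.
Qed.

Lemma eval_copy a d t (s : store) l : uniq [:: a; d; t] -> s t = [::] -> s a = map Some l ->
  size l <= B -> eval B (copy a d t) s = upd s d (s d ++ s a).
Proof.
rewrite cons_uniq !inE negb_or => /andP[/andP[ad at_] /andP[]].
rewrite inE => dt _ st sa sz; rewrite eval_then.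
rewrite (@eval_move a _ s l) ?cons_uniq ?inE ?negb_or ?ad ?at_ //; last by rewrite eq_sym dt.
rewrite (@eval_move t _ _ l) ?inE //.
- apply: functional_extensionality => r; rewrite /upd !inE eqxx [t == a]eq_sym (negPf at_) /=.
  case: (r =P t) => [->|_]; first by rewrite [t == d]eq_sym (negPf dt) st.
  case: (r =P a) => [->|_] /=; first by rewrite (negPf ad) st.
  by case: eqP => // ->.
- by rewrite eq_sym.
- by rewrite eqxx /= st eq_sym (negPf at_).
Qed.

Lemma eval_clear a (s : store) : size (s a) <= B * B -> eval B (clear a) s = upd s a [::].
Proof.
have one n x : iter n (eval B (Pop a Skip Skip Skip)) x = upd x a (drop n (x a)).
  elim: n x => [|n IH] x; first by rewrite drop0 upd_id.
  have E : eval B (Pop a Skip Skip Skip) x = upd x a (behead (x a)).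
    by move=> /=; case: (x a) => [|[[]|] q].
  by rewrite iterSr IH E updE upd_upd; case: (x a).
move=> sz /=.
have -> : upd s a [::] = upd s a (drop (B * B) (s a)) by rewrite drop_oversize.
elim: {1 3}B s {sz} => [|m IH] s /=; first by rewrite drop0 upd_id.
by rewrite IH one updE upd_upd mulSn drop_drop addnC.
Qed.

Lemma eval_transfer rF q ds1 ds0 (s : store) v rest : uniq ds1 -> uniq ds0 ->
  rF \notin ds1 -> rF \notin ds0 -> rF != q -> s rF = [::] -> s q = num v ++ rest -> v < B ->
  eval B (transfer rF q ds1 ds0) s = fun r => (if r == q then rest else s r) ++
     nseq (v * (r \in ds1)) t1 ++ nseq (r \in ds0) f0.
Proof.
move=> u1 u0 F1 F0 Fq sF sq lv.
(* [G k.+1] has [k] units still to be read and the flag set; [G 0] comes after the terminating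
   [false]. These are [v + 1] rounds, hence [v < B]. *)
pose G k : store := if k is k.+1 then fun r => (if r == rF then [:: t1] else if r == q then num k ++ rest
    else s r) ++ nseq ((v - k) * (r \in ds1)) t1
  else fun r => (if r == q then rest else s r) ++ nseq (v * (r \in ds1)) t1 ++ nseq (r \in ds0) f0.
rewrite eval_then; have -> : eval B (Push rF t1) s = G v.+1.
  apply: functional_extensionality => r; rewrite /G [eval _ _ _]/= subnn /= cats0 /upd sF; case: eqP => // _.
  by case: eqP => // ->.
apply: rep_nat lv.
- move=> k lk; rewrite /=; have -> : rF \in ds1 = false by apply/negbTE.
  rewrite eqxx muln0 /=; set s1 := upd _ _ _.
  have s1E r : s1 r = if r == rF then [::] else (if r == q then num k ++ rest else s r) ++ nseq ((v - k) * (r \in ds1)) t1.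
    by rewrite /s1 /upd; case: eqP.
  have -> : s1 q = (num k ++ rest) ++ nseq ((v - k) * (q \in ds1)) t1.
    by rewrite s1E eqxx eq_sym (negPf Fq).
  case: k lk s1 s1E => [|k] lk s1 s1E.
    rewrite num0 /= eval_push_all //; apply: functional_extensionality => r; rewrite subn0 /upd.
    case: (r =P q) => [->|/eqP/negPf ne]; first by rewrite catA.
    rewrite s1E catA ne subn0; case: (r =P rF) => [->|_] //=.
    by rewrite (negPf F1) muln0 cats0 sF.
  rewrite numS /= eval_push_all //; apply: functional_extensionality => r; rewrite /upd.
  have e : v - k = (v - k.+1).+1 by lia.
  have cc (T : seq sym) (b : bool) : (T ++ nseq ((v - k.+1) * b) t1) ++ nseq b t1 = T ++ nseq ((v - k) * b) t1.
    by rewrite -catA -nseqD; congr (_ ++ nseq _ _); rewrite e mulSn addnC.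
  case: (r =P rF) => [->|ne]; first by rewrite (negPf Fq) s1E eqxx (negPf F1) /= muln0.
  case: (r =P q) => [->|ne']; first by rewrite cc.
  by rewrite s1E !(introF eqP) // cc.
- rewrite /= sF (negPf Fq) (negPf F1) (negPf F0) muln0 /=.
  by apply: functional_extensionality => r; rewrite /upd; case: eqP => // ->; rewrite (negPf Fq) sF (negPf F1) (negPf F0) muln0.
Qed.

End Rules.

(** * The verifier *)

(** [rC] holds the input and later the certificate, [rC'] the certificate bits already read, [rP]
    the cyclic queue of operations, [rV] that of computed elements. For the current operation, [rK]
    counts the missing arguments, [rPw] is [n] to the number of supplied ones, and [rIdx] is their
    table index. The pair under test is in [rX] and [rY], the prescribed value in [rT], and [rBad]
    counts errors. *)
Notation rC := 0 (only parsing).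
Notation rC' := 1 (only parsing).
Notation rN := 2 (only parsing).
Notation rN' := 3 (only parsing).
Notation rOps := 4 (only parsing).
Notation rOps' := 5 (only parsing).
Notation rP := 6 (only parsing).
Notation rV := 7 (only parsing).
Notation rK := 8 (only parsing).
Notation rPw := 9 (only parsing).
Notation rIdx := 10 (only parsing).
Notation rTmp := 11 (only parsing).
Notation rX := 12 (only parsing).
Notation rY := 13 (only parsing).
Notation rRx := 14 (only parsing).
Notation rRy := 15 (only parsing).
Notation rF := 16 (only parsing).
Notation rT := 17 (only parsing).
Notation rBad := 18 (only parsing).
Definition nregs := 19.

(** The default [kap] is the common content of all counters; the scratch registers [rN'], [rOps'],
    [rTmp], [rF] are empty between commands. *)
Definition memory kap c c' n ops p v k pw idx x y rx ry t bad : store :=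
  nth kap [:: c; c'; n; [::]; ops; [::]; p; v; k; pw; idx; [::]; x; y; rx; ry; [::]; t; bad].

Ltac memoryE := apply: functional_extensionality; rewrite /upd /memory;
  do 19 (case=> [|]; [ rewrite /= ?cats0 // | ]); move=> r; rewrite /= ?nth_nil ?cats0 //.

Definition mul a := Then (drain a Skip (copy rN rTmp rN')) (move rTmp [:: a]).
(** When it is called, [rPw] has one tick per table entry. The index reaches its terminating [false]
    exactly at the wanted entry, which is copied to [rV]; every entry moves to the back of [rP]. *)
Definition lookup :=
  drain rPw Skip (Pop rIdx (transfer rF rP [:: rP] [:: rP]) (transfer rF rP [:: rP; rV] [:: rP; rV])
                           (transfer rF rP [:: rP] [:: rP])).
Definition load := Then (transfer rF rP [:: rP; rK] [:: rP]) (Push rPw t1).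
Definition finish := Then (Push rIdx f0) (Then lookup load).
Definition rotate := transfer rF rV [:: rV] [:: rV].
(** Horner's rule for the table index. The second pop of [rK] only tests for emptiness and puts its
    tick back. *)
Definition take_arg :=
  Then (mul rIdx) (Then (mul rPw) (Then (transfer rF rV [:: rV; rIdx] [:: rV])
    (Then (Pop rK Skip Skip Skip) (Pop rK finish finish (Push rK t1))))).
Definition execute :=
  Then (drain rC (Then (Push rC' f0) rotate) (Then (Push rC' t1) take_arg)) (move rC' [:: rC]).

Definition compare :=
  drain rT (Pop rV (Push rBad t1) Skip (Push rBad t1)) (Pop rV (Push rBad t1) (Push rBad t1) Skip).
Definition put_num a := Then (copy a rV rTmp) (Push rV f0).
Definition prepare a b c :=
  Then (put_num a) (Then (put_num b) (Then (put_num c) (Then (Then (copy rY rT rTmp) (Push rT f0))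
    (Then (copy rOps rP rOps') load)))).
Definition cleanup :=
  Then (clear rV) (Then (clear rP) (Then (clear rK) (Then (clear rPw) (clear rIdx)))).
Definition test a b c := Then (prepare a b c) (Then execute (Then compare cleanup)).
Definition tests :=
  Then (test rY rX rX) (Then (test rX rY rX) (Then (test rX rX rY) (Push rX t1))).
Definition x_loop := Then (copy rN rRx rTmp) (Then (drain rRx Skip tests) (clear rX)).
Definition y_loop := Then (copy rN rRy rTmp) (drain rRy Skip (Then x_loop (Push rY t1))).
(** [rF] stays nonempty until the mark has been removed, so surplus rounds leave the certificate
    alone. *)
Definition parse_ops :=
  Then (Push rF t1) (drain rF Skip (Pop rC Skip (Then (Push rOps f0) (Push rF t1))
                                            (Then (Push rOps t1) (Push rF t1)))).
Definition checker := Then (transfer rF rC [:: rN] [::]) (Then parse_ops y_loop).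

Lemma checker_registers : registers_below nregs checker.
Proof. by []. Qed.

#[local] Opaque transfer move copy clear.

Definition nums (l : seq nat) : seq sym := flatten (map num l).

(** * Derivations read off bit strings, over an arbitrary type of values *)

Section Abstract.
Variables (T : Type) (ar : nat -> nat) (app : nat -> seq T -> T) (d : T).

(* Cyclic list of operations, arguments collected for the first of them, cyclic list of
   computed elements. *)
Definition state := (seq nat * seq T * seq T)%type.

(** The type [T] is left open because the same bits are run on numbers, on terms and on tuples. *)
Definition astep (s : state) (b : bool) : state :=
  let: (L, args, V) := s in
  let args' := rcons args (head d V) in
  if ~~ b then (L, args, rot 1 V)
  else if size args' == ar (head 0 L)
       then (rot 1 L, [::], rcons (rot 1 V) (app (head 0 L) args'))
       else (L, args', rot 1 V).

End Abstract.

Lemma nums_cat a b : nums (a ++ b) = nums a ++ nums b.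
Proof. by rewrite /nums map_cat flatten_cat. Qed.

Lemma nums_rcons a v : nums (rcons a v) = nums a ++ num v.
Proof. by rewrite -cats1 nums_cat /nums /= cats0. Qed.

(** * Evaluation of the verifier's programs *)

Section Correct.
Variables (B n : nat) (kap : seq sym) (ops : seq (nat * seq nat)).
Let ar f := (nth (0, [::]) ops f).1.
Let tab f := (nth (0, [::]) ops f).2.
Hypotheses (n_gt0 : 0 < n) (n_lt : n < B).
Hypothesis ops_wf : forall f, f < size ops ->
  [/\ 0 < ar f, ar f < B, n ^ ar f <= B, size (tab f) = n ^ ar f & all (fun v => v < n) (tab f)].

Lemma eval_mul a (s : store) i : a \notin [:: rN; rN'; rTmp] ->
  s a = ones i -> s rN = ones n -> s rN' = [::] -> s rTmp = [::] -> i * n <= B ->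
  eval B (mul a) s = upd s a (ones (i * n)).
Proof.
rewrite !inE !negb_or => /and3P[aN aN' aT] sa sN sN' sT le.
have onesE m : ones m = map Some (nseq m true) by rewrite map_nseq.
pose G k := upd (upd s a (ones k)) rTmp (ones ((i - k) * n)).
have le_i : i <= B by apply: leq_trans le; rewrite leq_pmulr.
rewrite eval_then; have -> : eval B (drain a Skip (copy rN rTmp rN')) s = G 0.
  have -> : s = G i by rewrite /G subnn mul0n -sa upd_id -[ones 0]sT upd_id.
  apply: rep_nat le_i => [k lk|].
    have E : upd (G k.+1) a (behead (G k.+1 a)) = upd (upd s rTmp (ones ((i - k.+1) * n))) a (ones k).
      apply: functional_extensionality => r; rewrite /G /upd eqxx (negPf aT).
      by case: (r =P a).
    rewrite /= E {1}/G /upd (negPf aT) eqxx /= -/(upd s _ _) -/(upd (upd s _ _) a _).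
    change (eval B (copy rN rTmp rN') (upd (upd s rTmp (ones ((i - k.+1) * n))) a (ones k)) = G k).
    rewrite (@eval_copy B _ _ _ _ (nseq n true)) //.
    + apply: functional_extensionality => r; rewrite /G /upd ![_ == a]eq_sym (negPf aT) (negPf aN) /= sN ones_add.
      case: (r =P rTmp) => // _; have -> : i - k = (i - k.+1).+1 by lia.
      by rewrite mulSn addnC.
    + by rewrite /upd eq_sym (negPf aN').
    + by rewrite /upd eq_sym (negPf aN) /= sN onesE.
    + by rewrite size_nseq ltnW.
  rewrite /= {1}/G /upd (negPf aT) eqxx /=.
  by apply: functional_extensionality => r; rewrite /G /upd eqxx (negPf aT); case: (r =P a) => [->|//]; rewrite (negPf aT).
rewrite (@eval_move B _ _ _ (nseq (i * n) true)) ?inE //.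
- apply: functional_extensionality => r; rewrite /G /upd !inE subn0.
  case: (r =P a) => [->|_]; first by rewrite (negPf aT).
  by case: eqP => // ->; rewrite sT.
- by rewrite eq_sym.
- by rewrite /G /upd eqxx subn0 onesE.
- by rewrite size_nseq.
Qed.

#[local] Opaque mul.

(** Stores are kept in the form [nth kap L], on which updates compute. *)
Lemma upd_nth L j q : j < size L -> upd (nth kap L) j q = nth kap (set_nth [::] L j q).
Proof.
move=> lt; apply: functional_extensionality => r; rewrite /upd.
case: (ltnP r (size L)) => [lr|ge].
  by rewrite [RHS](set_nth_default [::]) ?size_set_nth ?leq_max ?lr ?orbT // nth_set_nth /=; case: eqP => // _; apply: set_nth_default.
rewrite !nth_default ?size_set_nth ?geq_max ?lt ?ge // ?(leq_trans lt) //.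
by case: eqP => // E; move: lt; rewrite -E ltnNge ge.
Qed.

Lemma transfer_nth q ds1 ds0 L v rest : uniq ds1 -> uniq ds0 -> rF \notin ds1 -> rF \notin ds0 ->
  q < size L -> all (fun r => r < size L) ds1 -> all (fun r => r < size L) ds0 -> rF < size L ->
  rF != q -> nth [::] L rF = [::] -> nth [::] L q = num v ++ rest -> v < B ->
  eval B (transfer rF q ds1 ds0) (nth kap L) =
  nth kap (mkseq (fun r => (if r == q then rest else nth [::] L r) ++
     nseq (v * (r \in ds1)) t1 ++ nseq (r \in ds0) f0) (size L)).
Proof.
move=> u1 u0 F1 F0 lq a1 a0 lF Fq LF Lq lv.
rewrite (@eval_transfer B rF q ds1 ds0 _ v rest) //.
- apply: functional_extensionality => r; case: (ltnP r (size L)) => [lr|ge].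
    by rewrite [RHS](set_nth_default [::]) ?size_mkseq // nth_mkseq // (set_nth_default [::]).
  rewrite !nth_default ?size_mkseq //; case: eqP => [E|_].
    by move: lq; rewrite -E ltnNge ge.
  have notin ds : all (fun r => r < size L) ds -> r \in ds = false.
    by move=> /allP a; apply/negP => /a; rewrite ltnNge ge.
  by rewrite !notin // muln0 cats0.
- by rewrite (set_nth_default [::]).
- by rewrite (set_nth_default [::]).
Qed.

Lemma nums_cons v l : nums (v :: l) = num v ++ nums l. Proof. by []. Qed.

Lemma eval_lookup c c' o tb rest v k i x y rx ry t bad :
  all (fun v => v < n) tb -> i < size tb <= B ->
  eval B lookup (memory kap c c' (ones n) o (nums tb ++ rest) v k (ones (size tb)) (num i) x y rx ry t bad)
  = memory kap c c' (ones n) o (rest ++ nums tb) (v ++ num (nth 0 tb i)) k [::] [::] x y rx ry t bad.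
Proof.
move=> tb_lt /andP[li lB]; set m := size tb.
(* With [k'] entries to go, the first [m - k'] have moved to the back, and the index is used up once
   [i < m - k']. *)
pose G k' := memory kap c c' (ones n) o (nums (drop (m - k') tb) ++ rest ++ nums (take (m - k') tb))
  (if i < m - k' then v ++ num (nth 0 tb i) else v) k (ones k')
  (if i < m - k' then [::] else num (i - (m - k'))) x y rx ry t bad.
have -> : memory kap c c' (ones n) o (nums tb ++ rest) v k (ones m) (num i) x y rx ry t bad = G m.
  by rewrite /G subnn drop0 take0 ltn0 subn0 cats0.
have -> : memory kap c c' (ones n) o (rest ++ nums tb) (v ++ num (nth 0 tb i)) k [::] [::] x y rx ry t bad = G 0.
  by rewrite /G subn0 li drop_size take_size.
apply: rep_nat lB => [k' lk|]; last by rewrite /= /G /memory upd_nth.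
set j := m - k'.+1; have lj : j < m by rewrite /j -/m; lia.
have e : m - k' = j.+1 by rewrite /j; lia.
have vj : nth 0 tb j < B by apply: leq_trans n_lt; apply/leqW/(allP tb_lt)/mem_nth.
rewrite /G e -/j (drop_nth 0 lj) (take_nth 0 lj) nums_cons nums_rcons -catA.
rewrite /memory [eval _ _ _]/= upd_nth // [set_nth _ _ _ _]/=.
case: (ltngtP i j) => [lt|gt|eq].
- rewrite ltnS (ltnW lt) [ohead _]/= [behead _]/= upd_nth // [set_nth _ _ _ _]/=.
  rewrite (@transfer_nth _ _ _ _ _ (nums (drop j.+1 tb) ++ rest ++ nums (take j tb)) _ _ _ _ _ _ _ _ _ _ _ vj) //.
    by rewrite /mkseq /= !muln0 muln1 !cats0 !numE -!cats1 !catA.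
- rewrite ltnS leqNgt gt -[i - j]prednK ?subn_gt0 // numS [ohead _]/= [behead _]/= upd_nth // [set_nth _ _ _ _]/=.
  rewrite (@transfer_nth _ _ _ _ _ (nums (drop j.+1 tb) ++ rest ++ nums (take j tb)) _ _ _ _ _ _ _ _ _ _ _ vj) //.
  by rewrite /mkseq /= !muln0 muln1 !cats0 !numE -!cats1 !catA -subnS.
- rewrite eq subnn num0 ltnSn [ohead _]/= [behead _]/= upd_nth // [set_nth _ _ _ _]/=.
  rewrite (@transfer_nth _ _ _ _ _ (nums (drop j.+1 tb) ++ rest ++ nums (take j tb)) _ _ _ _ _ _ _ _ _ _ _ vj) //.
  by rewrite /mkseq /= !muln0 muln1 !cats0 !numE -!cats1 !catA.
Qed.

Lemma eval_rotate c c' N o p v V k pw idx x y rx ry t bad : v < n ->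
  eval B rotate (memory kap c c' N o p (nums (v :: V)) k pw idx x y rx ry t bad)
  = memory kap c c' N o p (nums (rcons V v)) k pw idx x y rx ry t bad.
Proof.
move=> lv; rewrite /memory /rotate.
rewrite (@transfer_nth _ _ _ _ v (nums V)) //; last exact: ltn_trans n_lt.
by rewrite /mkseq /= !muln0 muln1 !cats0 nums_rcons numE -cats1 !catA.
Qed.

Lemma eval_load c c' N o rest v k x y rx ry t bad : k < B ->
  eval B load (memory kap c c' N o (num k ++ rest) v [::] [::] [::] x y rx ry t bad)
  = memory kap c c' N o (rest ++ num k) v (ones k) (ones 1) [::] x y rx ry t bad.
Proof.
move=> lk; rewrite /memory /load eval_then.
rewrite (@transfer_nth _ _ _ _ k rest) // /mkseq /= !muln0 muln1 !cats0.
by rewrite upd_nth //= numE -cats1 !catA.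
Qed.

Lemma eval_finish c c' o tb rest v i x y rx ry t bad k2 rest2 :
  all (fun v => v < n) tb -> i < size tb <= B -> rest ++ nums tb = num k2 ++ rest2 -> k2 < B ->
  eval B finish (memory kap c c' (ones n) o (nums tb ++ rest) v [::] (ones (size tb)) (ones i) x y rx ry t bad)
  = memory kap c c' (ones n) o (rest2 ++ num k2) (v ++ num (nth 0 tb i)) (ones k2) (ones 1) [::] x y rx ry t bad.
Proof.
move=> tb_lt li E k2B; rewrite /finish 2!eval_then.
have -> : eval B (Push rIdx f0) (memory kap c c' (ones n) o (nums tb ++ rest) v [::] (ones (size tb)) (ones i) x y rx ry t bad) =
  memory kap c c' (ones n) o (nums tb ++ rest) v [::] (ones (size tb)) (num i) x y rx ry t bad.
  by rewrite /memory /= upd_nth //= -numE.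
by rewrite eval_lookup // E eval_load.
Qed.

Lemma eval_take_arg c c' o p v V k pw i x y rx ry t bad : v < n -> i * n <= B -> pw * n <= B ->
  eval B take_arg (memory kap c c' (ones n) o p (nums (v :: V)) (ones k.+1) (ones pw) (ones i) x y rx ry t bad)
  = (if k is 0 then eval B finish else id)
    (memory kap c c' (ones n) o p (nums (rcons V v)) (ones k) (ones (pw * n)) (ones (i * n + v)) x y rx ry t bad).
Proof.
move=> lv li lpw; rewrite /take_arg 4!eval_then /memory.
rewrite (@eval_mul rIdx _ i) // upd_nth //= (@eval_mul rPw _ pw) // upd_nth //=.
rewrite (@transfer_nth _ _ _ _ v (nums V)) //; last exact: ltn_trans n_lt.
rewrite /mkseq /= upd_nth //= !muln0 muln1 !cats0 ones_add cats1 -/(ones v) -numE -nums_rcons.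
case: k => [|k] /=; rewrite upd_nth //=.
by rewrite upd_nth //= rcons_ones.
Qed.

#[local] Opaque finish rotate take_arg.

Definition enc f : seq sym := num (ar f) ++ nums (tab f).

(* The arity of the current operation has been read and moved to the end of the queue. *)
Definition table_queue (L : seq nat) : seq sym :=
  nums (tab (head 0 L)) ++ flatten (map enc (behead L)) ++ num (ar (head 0 L)).

(** The registers are a function of the abstract state, so that processing a bit becomes an equation
    between stores. *)
Definition smem c c' (s : state nat) x y rx ry t bad : store :=
  let: (L, args, V) := s in
  memory kap c c' (ones n) (flatten (map enc (iota 0 (size ops)))) (table_queue L) (nums V)
    (ones (ar (head 0 L) - size args)) (ones (n ^ size args)) (ones (tab_index n args)) x y rx ry t bad.

Definition good (s : state nat) : Prop :=
  let: (L, args, V) := s in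
  [/\ L != [::] /\ all (fun f => f < size ops) L, size args < ar (head 0 L),
      all (fun v => v < n) args, V != [::] & all (fun v => v < n) V].

Definition app f args := apply_op n (nth (0, [::]) ops f) args.

Definition step := astep ar app 0.

Lemma tab_index_lt args : all (fun v => v < n) args -> tab_index n args < n ^ size args.
Proof.
elim/last_ind: args => // args v IH; rewrite all_rcons => /andP[lv /IH {}IH].
rewrite /tab_index foldl_rcons -/(tab_index n args) size_rcons expnSr.
by apply: (@leq_trans ((tab_index n args).+1 * n)); [rewrite mulSn addnC ltn_add2r | rewrite leq_mul2r IH orbT].
Qed.

Lemma app_lt f args : f < size ops -> size args = ar f -> all (fun v => v < n) args -> app f args < n.
Proof.
move=> lf sa al; have [_ _ _ st at_] := ops_wf lf.
by apply: (allP at_); apply: mem_nth; rewrite st -sa tab_index_lt.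
Qed.

Lemma good_step s b : good s -> good (step s b).
Proof.
case: s => [[L args] [|v V]] [[L0 aL] sa aa V0 aV] //.
have aV' : all (fun v => v < n) (rot 1 (v :: V)).
  by apply/allP => u; rewrite mem_rot; apply: (allP aV).
have V0' : rot 1 (v :: V) != [::] by rewrite rot1_cons -size_eq0 size_rcons.
have aa' : all (fun v => v < n) (rcons args v) by rewrite all_rcons aa andbT; case/andP: aV.
case: b => //=; case: eqP => [E|ne]; last first.
  by split => //; rewrite ltn_neqAle; apply/andP; split; [exact/eqP | rewrite size_rcons].
case: L L0 aL sa E => // h L _ aL /= _ E.
have lh : h < size ops by case/andP: aL.
split => //.
- split; first by rewrite rot1_cons -size_eq0 size_rcons.
  by apply/allP => u; rewrite mem_rot; apply: (allP aL).
- rewrite rot1_cons; case: L aL => [|h2 L] /=; first by case: (ops_wf lh).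
  by case/and3P => _ /ops_wf[].
- by rewrite -size_eq0 size_rcons.
- by rewrite all_rcons aV' app_lt.
Qed.

Lemma eval_step c c' (s : state nat) (b : bool) x y rx ry t bad : good s ->
  eval B (if b then take_arg else rotate) (smem c c' s x y rx ry t bad) = smem c c' (step s b) x y rx ry t bad.
Proof.
case: s => [[L args] [|v V]] [[L0 aL] sa aa V0 aV] //.
have lv : v < n by case/andP: aV.
case: b; last by rewrite /smem eval_rotate // /step /= rot1_cons.
case: L L0 aL sa => // h L _ /andP[lh aL] sa; rewrite [head _ _]/= in sa.
have [ar_gt0 arB powB st at_] := ops_wf lh.
have lpow : n ^ (size args).+1 <= B by apply: leq_trans powB; apply: leq_pexp2l.
have lidx := tab_index_lt aa.
rewrite /smem [head _ _]/= -[ar h - _]prednK ?subn_gt0 // eval_take_arg //; last by rewrite -expnSr.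
  rewrite -expnSr.
  have tiE : tab_index n args * n + v = tab_index n (rcons args v) by rewrite /tab_index foldl_rcons.
  have aa' : all (fun v => v < n) (rcons args v) by rewrite all_rcons lv.
  rewrite /step /= tiE size_rcons; case: eqP => [E|ne].
    have -> : (ar h - size args).-1 = 0 by rewrite -E; lia.
    have st' : n ^ (size args).+1 = size (tab h) by rewrite st E.
    (* The next operation, which is [h] again if there is only one. *)
    pose h2 := head 0 (rcons L h).
    have lh2 : h2 < size ops by rewrite /h2; case: (L) aL => //= h' L' /andP[].
    have [ar2_gt0 ar2B _ _ _] := ops_wf lh2.
    rewrite /table_queue /= st' (@eval_finish _ _ _ (tab h) _ _ _ _ _ _ _ _ _ (ar h2)
       (nums (tab h2) ++ flatten (map enc (behead (rcons L h))))) //.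
    - by rewrite !rot1_cons -/h2 subn0 !nums_rcons -!catA.
    - by have := tab_index_lt aa'; rewrite size_rcons E -st => ->; rewrite st powB.
    - rewrite -catA -[num (ar h) ++ _]/(enc h) catA /h2.
      by case: (L) => [|h' L'] /=; rewrite ?cats0 // map_rcons flatten_rcons -!catA.
  have -> : (ar h - size args).-1 = ar h - (size args).+1 by lia.
  case E: (ar h - (size args).+1) => [|k]; first by exfalso; apply: ne; lia.
  by rewrite /= !rot1_cons size_rcons E.
apply: leq_trans lpow; rewrite expnSr leq_mul2r; apply/orP; right; exact: ltnW.
Qed.

Lemma good_run s cert : good s -> good (foldl step s cert).
Proof. by elim: cert s => //= b cert IH s /(good_step b); apply: IH. Qed.

Lemma eval_execute (cert : seq bool) (s : state nat) x y rx ry t bad : good s -> size cert <= B ->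
  eval B execute (smem (map Some cert) [::] s x y rx ry t bad) =
  smem (map Some cert) [::] (foldl step s cert) x y rx ry t bad.
Proof.
move=> gs sz; rewrite eval_then.
pose G (p : seq bool * state nat) (l : seq bool) := smem (map Some l) (map Some p.1) p.2 x y rx ry t bad.
pose stp (p : seq bool * state nat) b := (rcons p.1 b, step p.2 b).
rewrite -[smem _ _ s _ _ _ _ _ _]/(G ([::], s) cert).
rewrite (@rep_foldl B _ _ (fun p _ => good p.2) G stp) //.
- have -> : foldl stp ([::], s) cert = (cert, foldl step s cert).
    suff E x' : foldl stp (x', s) cert = (x' ++ cert, foldl step s cert) by rewrite E.
    elim: cert x' (s) {sz} => [|b l IH] x' s' /=; first by rewrite cats0.
    by rewrite IH cat_rcons.
  rewrite /G /=; case: (foldl _ _ _) => [[L args] V].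
  by rewrite (@eval_move B _ _ _ cert) //; memoryE.
- move=> [x' s'] b l /= gs'; split; last exact: good_step.
  have -> : G (rcons x' b, step s' b) l = eval B (if b then take_arg else rotate)
      (smem (map Some l) (rcons (map Some x') (Some b)) s' x y rx ry t bad).
    by rewrite eval_step // -map_rcons.
  rewrite /G; case: s' gs' => [[L args] V] gs'; rewrite /smem /memory /=.
  by case: b; rewrite /= !upd_nth.
- by move=> [x' [[L args] V]]; rewrite /G /= /memory upd_nth.
Qed.

Fixpoint mismatches (t : seq bool) (v : seq sym) : nat :=
  if t is a :: t' then (ohead v != Some (Some a)) + mismatches t' (behead v) else 0.

(** Unary codes form a prefix code, so the first [y + 1] symbols decide equality whatever
    follows. *)
Lemma mismatches_num y v rest : (mismatches (unary y) (num v ++ rest) == 0) = (v == y).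
Proof.
elim: y v => [|y IH] [|v] //.
  have -> : unary y.+1 = true :: unary y by [].
  by rewrite numS cat_cons /= IH.
Qed.

Lemma eval_compare c c' N o p v k pw idx x y rx ry (tl : seq bool) z : size tl <= B ->
  eval B compare (memory kap c c' N o p v k pw idx x y rx ry (map Some tl) (ones z)) =
  memory kap c c' N o p (drop (size tl) v) k pw idx x y rx ry [::] (ones (z + mismatches tl v)).
Proof.
move=> sz.
pose G (a : seq sym * nat) (l : seq bool) := memory kap c c' N o p a.1 k pw idx x y rx ry (map Some l) (ones a.2).
pose stp (a : seq sym * nat) (b : bool) := (behead a.1, a.2 + (ohead a.1 != Some (Some b))).
rewrite -[memory _ _ _ _ _ _ _ _ _ _ _ _ _ _ (map _ _) _]/(G (v, z) tl).
rewrite (@rep_foldl B _ _ (fun _ _ => True) G stp) //.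
- have -> : foldl stp (v, z) tl = (drop (size tl) v, z + mismatches tl v) => //.
  elim: tl v z {sz} => [|b l IH] v' z' /=; first by rewrite drop0 addn0.
  by rewrite IH addnA; case: v' => //=; rewrite !drop_nil.
- move=> [v' z'] b l _; split=> //; rewrite /G /stp /memory /=.
  by case: b; case: v' => [|[[]|] v'] /=; rewrite ?upd_nth //= ?upd_nth //= ?upd_nth //= ?addn1 ?addn0 ?rcons_ones.
- by move=> [v' z']; rewrite /G /memory /= upd_nth.
Qed.

Let op_bits : seq bool := flatten [seq enc_op o | o <- ops].
Let op_queue : seq sym := flatten (map enc (iota 0 (size ops))).
Hypothesis ops_gt0 : 0 < size ops.
Hypothesis op_bits_le : size op_bits <= B.

Lemma enc_bits f : enc f = map Some (enc_op (nth (0, [::]) ops f)).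
Proof. by rewrite /enc_op map_cat map_flatten -map_comp. Qed.

Lemma op_queueE : op_queue = map Some op_bits.
Proof.
rewrite /op_queue /op_bits map_flatten -map_comp -{2}(mkseq_nth (0, [::]) ops) /mkseq -map_comp.
by congr flatten; apply: eq_map => f /=; rewrite enc_bits.
Qed.

Definition value x y r : nat := if r == rX then x else y.

Lemma eval_put c c' o p v x y rx ry t bad a : a \in [:: rX; rY] -> x < n -> y < n ->
  eval B (put_num a) (memory kap c c' (ones n) o p v [::] [::] [::] (ones x) (ones y) rx ry t bad) =
  memory kap c c' (ones n) o p (v ++ num (value x y a)) [::] [::] [::] (ones x) (ones y) rx ry t bad.
Proof.
move=> aXY lx ly; rewrite eval_then.
have lB k : k < n -> k <= B by move=> lk; apply: ltnW; apply: ltn_trans n_lt.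
move: aXY; rewrite !inE => /orP[] /eqP -> /=.
- rewrite (@eval_copy B _ _ _ _ (nseq x true)) ?size_nseq ?lB //; last by rewrite /memory /= map_nseq.
  by rewrite /memory upd_nth //= upd_nth //= numE -rcons_cat.
- rewrite (@eval_copy B _ _ _ _ (nseq y true)) ?size_nseq ?lB //; last by rewrite /memory /= map_nseq.
  by rewrite /memory upd_nth //= upd_nth //= numE -rcons_cat.
Qed.

Lemma eval_prepare c c' x y rx ry bad a1 a2 a3 :
  a1 \in [:: rX; rY] -> a2 \in [:: rX; rY] -> a3 \in [:: rX; rY] -> x < n -> y < n ->
  eval B (prepare a1 a2 a3)
    (memory kap c c' (ones n) op_queue [::] [::] [::] [::] [::] (ones x) (ones y) rx ry [::] bad) =
  smem c c' (iota 0 (size ops), [::], map (value x y) [:: a1; a2; a3])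
    (ones x) (ones y) rx ry (num y) bad.
Proof.
move=> h1 h2 h3 lx ly; rewrite /prepare 4!eval_then !eval_put //.
have lyB : y <= B by apply: ltnW; apply: ltn_trans n_lt.
set v := _ ++ _.
have -> : eval B (Then (copy rY rT rTmp) (Push rT f0))
    (memory kap c c' (ones n) op_queue [::] v [::] [::] [::] (ones x) (ones y) rx ry [::] bad) =
    memory kap c c' (ones n) op_queue [::] v [::] [::] [::] (ones x) (ones y) rx ry (num y) bad.
  rewrite eval_then (@eval_copy B _ _ _ _ (nseq y true)) ?size_nseq //; last by rewrite /memory /= map_nseq.
  by rewrite /memory upd_nth //= upd_nth //= numE.
rewrite eval_then (@eval_copy B _ _ _ _ op_bits) //; last by rewrite /memory /= op_queueE.
have [_ arB _ _ _] := ops_wf ops_gt0.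
have E : op_queue = num (ar 0) ++ (nums (tab 0) ++ flatten (map enc (iota 1 (size ops).-1))).
  by rewrite /op_queue -{1}(prednK ops_gt0) /= /enc -!catA.
rewrite /memory upd_nth // [set_nth _ _ _ _]/= {2}E.
rewrite -[nth kap _]/(memory kap c c' (ones n) op_queue _ v [::] [::] [::] (ones x) (ones y) rx ry (num y) bad).
rewrite eval_load // /smem /table_queue.
have -> : head 0 (iota 0 (size ops)) = 0 by rewrite -(prednK ops_gt0).
have -> : behead (iota 0 (size ops)) = iota 1 (size ops).-1 by rewrite -{1}(prednK ops_gt0).
by rewrite subn0 -catA /v /nums /= !cats0 -!catA.
Qed.

Lemma size_num v : size (num v) = v.+1.
Proof. by rewrite size_map size_rcons size_nseq. Qed.

(** The operations are only permuted, so the queue never outgrows the encoded tables; [cleanup]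
    relies on this. *)
Lemma size_table_queue L : L != [::] -> perm_eq L (iota 0 (size ops)) ->
  size (table_queue L) <= B.
Proof.
case: L => // h L _ /(perm_map (size \o enc)) /perm_sumn.
have E l : sumn (map (size \o enc) l) = size (flatten (map enc l)).
  by rewrite size_flatten /shape -map_comp.
rewrite !E -/op_queue op_queueE size_map => sz; apply: leq_trans op_bits_le.
by rewrite -sz /table_queue /= !size_cat; lia.
Qed.

Lemma perm_run s cert : perm_eq s.1.1 (iota 0 (size ops)) ->
  perm_eq (foldl step s cert).1.1 (iota 0 (size ops)).
Proof.
elim: cert s => //= b cert IH [[L args] V] pL; apply: IH.
by rewrite /step /=; case: b => //=; case: ifP => //= _; rewrite perm_rot.
Qed.

Lemma size_run s cert : size (foldl step s cert).2 <= size s.2 + size cert.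
Proof.
elim: cert s => [|b cert IH] s /=; first by rewrite addn0.
apply: leq_trans (IH _) _; rewrite addnS -addSn leq_add2r.
by case: s => [[L args] V]; case: b => /=; try case: ifP => _ /=; rewrite ?size_rcons size_rot // leqnSn.
Qed.

Lemma size_nums V : all (fun v => v < n) V -> size (nums V) <= size V * n.
Proof.
elim: V => // v V IH /= /andP[lv /IH le]; rewrite nums_cons size_cat size_num mulSn.
exact: leq_add.
Qed.

Lemma eval_cleanup c c' N o p v k pw idx x y rx ry t bad :
  all (fun q : seq sym => size q <= B * B) [:: p; v; k; pw; idx] ->
  eval B cleanup (memory kap c c' N o p v k pw idx x y rx ry t bad) =
  memory kap c c' N o [::] [::] [::] [::] [::] x y rx ry t bad.
Proof.
case/and5P=> hp hv hk hpw /andP[hi _]; rewrite /cleanup 4!eval_then /memory.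
by do 5 (rewrite [eval B _ (nth _ _)]eval_clear // upd_nth // [set_nth _ _ _ _]/=).
Qed.

(** * Running all tests and counting errors *)

Section Loops.
Variable cert : seq bool.
Hypothesis cert_le : 3 + size cert <= B.

Definition initial (V : seq nat) : state nat := (iota 0 (size ops), [::], V).
Definition result V := foldl step (initial V) cert.
Definition errors y V := mismatches (unary y) (nums (result V).2).
Definition base x y rx ry z : store :=
  memory kap (map Some cert) [::] (ones n) op_queue [::] [::] [::] [::] [::] (ones x) (ones y) rx ry [::] (ones z).

Lemma good_initial V : V != [::] -> all (fun v => v < n) V -> good (initial V).
Proof.
move=> V0 aV; have h0 : head 0 (iota 0 (size ops)) = 0 by rewrite -(prednK ops_gt0).
split=> //; first split; first by rewrite -size_eq0 size_iota -lt0n.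
  by apply/allP => f; rewrite mem_iota.
by rewrite h0; case: (ops_wf ops_gt0).
Qed.

Lemma eval_test a1 a2 a3 x y rx ry z :
  a1 \in [:: rX; rY] -> a2 \in [:: rX; rY] -> a3 \in [:: rX; rY] -> x < n -> y < n ->
  eval B (test a1 a2 a3) (base x y rx ry z) =
  base x y rx ry (z + errors y (map (value x y) [:: a1; a2; a3])).
Proof.
move=> h1 h2 h3 lx ly; rewrite /test 3!eval_then eval_prepare //.
set V := map (value x y) _.
have aV : all (fun v => v < n) V.
  by apply/allP => u /mapP[a _ ->]; rewrite /value; case: eqP.
have gV : good (initial V) by apply: good_initial.
have gR : good (result V) by apply: good_run.
rewrite eval_execute //; last by apply: leq_trans cert_le; rewrite leq_addl.
have pR : perm_eq (result V).1.1 (iota 0 (size ops)) by apply: perm_run.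
have sR : size (result V).2 <= B by exact: leq_trans (size_run (initial V) cert) cert_le.
rewrite /errors -/(initial V) -/(result V); case: (result V) gR pR sR => [[L args] W] [[L0 aL] sa aa W0 aW] pR sR.
have B_gt0 : 0 < B by apply: leq_trans n_lt.
have sq q : q <= B -> q <= B * B by move=> le; apply: leq_trans le _; rewrite leq_pmulr.
rewrite /smem eval_compare ?size_rcons ?size_nseq //; last exact: ltn_trans n_lt.
have lh : head 0 L < size ops by case: (L) L0 aL => //= h L' _ /andP[].
have [_ arB pB _ _] := ops_wf lh.
have lpow : n ^ size args <= B by apply: leq_trans pB; apply: leq_pexp2l; last exact: ltnW.
(* Only the list of computed elements uses the bound [B * B]: it consists of at most [B] numbers of
   at most [n] symbols each. *)
rewrite eval_cleanup // [all _ _]/= !size_nseq andbT; apply/and5P; split; [apply: sq| |apply: sq|apply: sq|apply: sq].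
- exact: size_table_queue.
- rewrite size_drop; apply: leq_trans (leq_subr _ _) _; apply: leq_trans (size_nums aW) _.
  by apply: leq_mul => //; apply: ltnW.
- by apply: leq_trans (ltnW arB); apply: leq_subr.
- exact: lpow.
- by apply: ltnW; apply: leq_trans lpow; apply: tab_index_lt.
Qed.

Definition test_errors x y := errors y [:: y; x; x] + errors y [:: x; y; x] + errors y [:: x; x; y].

Lemma eval_tests x y rx ry z : x < n -> y < n ->
  eval B tests (base x y rx ry z) = base x.+1 y rx ry (z + test_errors x y).
Proof.
move=> lx ly; rewrite /tests 3!eval_then !eval_test //.
by rewrite /base /memory /= upd_nth //= rcons_ones /test_errors !addnA.
Qed.

#[local] Opaque tests.

Definition row_errors y k := \sum_(x < k) test_errors x y.

Lemma eval_x_loop y ry z : y < n ->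
  eval B x_loop (base 0 y [::] ry z) = base 0 y [::] ry (z + row_errors y n).
Proof.
move=> ly; rewrite /x_loop 2!eval_then.
rewrite (@eval_copy B _ _ _ _ (nseq n true)) ?size_nseq ?(ltnW n_lt) //; last by rewrite /base /memory /= map_nseq.
(* [rRx] counts down while [rX] counts up, so [x] is [n - k] when [k] ticks are left. *)
pose G k := base (n - k) y (ones k) ry (z + row_errors y (n - k)).
have -> : upd (base 0 y [::] ry z) rRx (base 0 y [::] ry z rRx ++ base 0 y [::] ry z rN) = G n.
  by rewrite /G subnn /row_errors big_ord0 addn0 /base /memory upd_nth.
rewrite (rep_nat (G := G)) ?(ltnW n_lt) //.
- rewrite /G subn0 /base /memory eval_clear ?upd_nth //= size_nseq.
  by apply: leq_trans (ltnW n_lt) _; rewrite leq_pmulr // (leq_trans _ n_lt).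
- move=> k lk; have -> : eval B (Pop rRx Skip Skip tests) (G k.+1) =
    eval B tests (base (n - k.+1) y (ones k) ry (z + row_errors y (n - k.+1))).
    by rewrite /G /base /memory /= upd_nth.
  rewrite eval_tests //; last by lia.
  rewrite /G; have -> : n - k = (n - k.+1).+1 by lia.
  by rewrite /row_errors big_ord_recr /= addnA.
- by rewrite /G /base /memory /= upd_nth.
Qed.

#[local] Opaque x_loop.

Definition total_errors k := \sum_(y < k) row_errors y n.

Lemma eval_y_loop :
  eval B y_loop (base 0 0 [::] [::] 0) = base 0 n [::] [::] (total_errors n).
Proof.
rewrite /y_loop eval_then.
rewrite (@eval_copy B _ _ _ _ (nseq n true)) ?size_nseq ?(ltnW n_lt) //; last by rewrite /base /memory /= map_nseq.
pose G k := base 0 (n - k) [::] (ones k) (total_errors (n - k)).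
have -> : upd (base 0 0 [::] [::] 0) rRy (base 0 0 [::] [::] 0 rRy ++ base 0 0 [::] [::] 0 rN) = G n.
  by rewrite /G subnn /total_errors big_ord0 /base /memory upd_nth.
rewrite (rep_nat (G := G)) ?(ltnW n_lt) //.
- by rewrite /G subn0.
- move=> k lk; have -> : eval B (Pop rRy Skip Skip (Then x_loop (Push rY t1))) (G k.+1) =
    eval B (Push rY t1) (eval B x_loop (base 0 (n - k.+1) [::] (ones k) (total_errors (n - k.+1)))).
    by rewrite /G /base /memory /= upd_nth.
  rewrite eval_x_loop; last by lia.
  rewrite /base /memory /= upd_nth //= rcons_ones /G; have -> : n - k = (n - k.+1).+1 by lia.
  by rewrite /total_errors big_ord_recr.
- by rewrite /G /base /memory /= upd_nth.
Qed.

#[local] Opaque y_loop.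

Lemma eval_parse_ops q N l4 : size l4 < B ->
  eval B parse_ops (memory kap (map Some l4 ++ None :: q) [::] N [::] [::] [::] [::] [::] [::] [::] [::] [::] [::] [::] [::]) =
  memory kap q [::] N (map Some l4) [::] [::] [::] [::] [::] [::] [::] [::] [::] [::] [::].
Proof.
move=> sz; set m := size l4.
pose G k : store := if k is k.+1 then
    nth kap [:: map Some (drop (m - k) l4) ++ None :: q; [::]; N; [::]; map Some (take (m - k) l4);
      [::]; [::]; [::]; [::]; [::]; [::]; [::]; [::]; [::]; [::]; [::]; [:: t1]; [::]; [::]]
  else memory kap q [::] N (map Some l4) [::] [::] [::] [::] [::] [::] [::] [::] [::] [::] [::].
rewrite eval_then; have -> : eval B (Push rF t1) (memory kap (map Some l4 ++ None :: q) [::] N [::] [::] [::] [::] [::] [::] [::] [::] [::] [::] [::] [::]) = G m.+1.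
  by rewrite /G subnn drop0 take0 /memory /= upd_nth.
apply: rep_nat sz => [[_|k lk]|].
- by rewrite /G subn0 drop_oversize // take_oversize // /memory /= upd_nth //= upd_nth.
- have lj : m - k.+1 < size l4 by rewrite -/m; lia.
  rewrite /G; have -> : m - k = (m - k.+1).+1 by lia.
  rewrite (drop_nth true lj) (take_nth true lj) map_rcons /=.
  by case: (nth true l4 _); rewrite /= !upd_nth.
- by rewrite /G /memory /= upd_nth.
Qed.

#[local] Opaque parse_ops.

Lemma eval_checker : size op_bits < B ->
  eval B checker (memory kap (map Some (unary n ++ op_bits) ++ None :: map Some cert)
    [::] [::] [::] [::] [::] [::] [::] [::] [::] [::] [::] [::] [::] [::]) =
  base 0 n [::] [::] (total_errors n).
Proof.
move=> sz; rewrite /checker 2!eval_then map_cat -catA -/(num n).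
rewrite {1}/memory (@transfer_nth _ _ _ _ n (map Some op_bits ++ None :: map Some cert)) //.
rewrite /mkseq /= !muln0 muln1 !cats0.
rewrite -[nth kap _]/(memory kap (map Some op_bits ++ None :: map Some cert) [::] (ones n)
  [::] [::] [::] [::] [::] [::] [::] [::] [::] [::] [::] [::]).
by rewrite eval_parse_ops // -op_queueE eval_y_loop.
Qed.

Lemma errors_eq0 y V : V != [::] -> all (fun v => v < n) V ->
  (errors y V == 0) = (head 0 (result V).2 == y).
Proof.
move=> V0 aV; have := good_run cert (good_initial V0 aV).
by rewrite /errors -/(result V); case: (result V) => [[L args] [|v W]] [] // *; exact: mismatches_num.
Qed.

Lemma total_errors_eq0 : total_errors n = 0 <-> forall x y, x < n -> y < n ->
  forall V, V \in [:: [:: y; x; x]; [:: x; y; x]; [:: x; x; y]] -> head 0 (result V).2 = y.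
Proof.
split=> [/eqP|H].
- rewrite /total_errors sum_nat_eq0 => /forallP H x y lx ly V.
  have := H (Ordinal ly); rewrite /= /row_errors sum_nat_eq0 => /forallP /(_ (Ordinal lx)).
  rewrite /= /test_errors !addn_eq0 !errors_eq0 //= ?lx ?ly //.
  by rewrite !inE => /andP[/andP[/eqP h1 /eqP h2] /eqP h3] /or3P[] /eqP ->.
- apply/eqP; rewrite /total_errors sum_nat_eq0; apply/forallP => y; apply/implyP => _.
  rewrite /row_errors sum_nat_eq0; apply/forallP => x; apply/implyP => _.
  rewrite /test_errors !addn_eq0 !errors_eq0 //= ?ltn_ord //.
  by rewrite !(H x y (ltn_ord x) (ltn_ord y)) ?inE ?eqxx ?orbT.
Qed.

End Loops.
End Correct.

(** * Short derivations in powers of a Maltsev algebra *)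

Section Powers.
Variables (n m : nat) (ar : nat -> nat) (op : nat -> seq 'I_n -> 'I_n).

Definition vec (I : finType) := {ffun I -> 'I_n}.

Section OnePower.
Variable I : finType.
Implicit Types (X Y Z s : seq (vec I)) (v : vec I).

Definition vop f (args : seq (vec I)) : vec I := [ffun i => op f [seq v i | v : vec I <- args]].

Definition one_step X v : Prop :=
  exists f args, [/\ f < m, size args = ar f, {subset args <= X} & v = vop f args].

Fixpoint derivation X s : Prop :=
  if s is v :: s' then one_step X v /\ derivation (v :: X) s' else True.

(** Straight-line programs with at most [k] instructions; intermediate results can be reused, so
    lengths simply add up in [gen_trans]. *)
Definition gen k X Y : Prop :=
  exists s, [/\ size s <= k, derivation X s & {subset Y <= X ++ s}].

Definition closed_under_ops (C : vec I -> Prop) : Prop :=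
  forall f args, f < m -> size args = ar f -> (forall v, v \in args -> C v) -> C (vop f args).

Lemma derivation_sub X X' s : {subset X <= X'} -> derivation X s -> derivation X' s.
Proof.
elim: s X X' => //= v s IH X X' sub [[f [args [lf sa al ->]]] D]; split.
  by exists f, args; split=> // u /al /sub.
by apply: IH D => u; rewrite !inE => /orP[->//|/sub ->]; rewrite orbT.
Qed.

Lemma derivation_cat X s t : derivation X s -> derivation (X ++ s) t -> derivation X (s ++ t).
Proof.
elim: s X => [|v s IH] X /=; first by rewrite cats0.
case=> st D D'; split=> //; apply: IH => //; apply: derivation_sub D' => u.
by rewrite !inE !mem_cat !inE orbCA.
Qed.

Lemma gen_weaken k k' X X' Y Y' : k <= k' -> {subset X <= X'} -> {subset Y' <= Y} ->
  gen k X Y -> gen k' X' Y'.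
Proof.
move=> lk sX sY [s [ls D sub]]; exists s; split; first exact: leq_trans lk.
  exact: derivation_sub D.
by move=> u /sY /sub; rewrite !mem_cat => /orP[/sX ->|->]; rewrite ?orbT.
Qed.

Lemma gen_refl X Y : {subset Y <= X} -> gen 0 X Y.
Proof. by move=> sub; exists [::]; split=> //; rewrite cats0. Qed.

Lemma gen_trans k k' X Y Z : gen k X Y -> gen k' (X ++ Y) Z -> gen (k + k') X (Y ++ Z).
Proof.
move=> [s [ls D sub]] [t [lt D' sub']].
have inc : {subset X ++ Y <= X ++ s}.
  by move=> u; rewrite mem_cat => /orP[uX|/sub //]; rewrite mem_cat uX.
exists (s ++ t); split; first by rewrite size_cat leq_add.
  by apply: derivation_cat D _; apply: derivation_sub D'.
move=> u; rewrite mem_cat catA => /orP[/sub uS|/sub']; first by rewrite mem_cat uS.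
by rewrite !mem_cat => /orP[uXY|->]; rewrite ?orbT //; have := inc u; rewrite !mem_cat uXY => ->.
Qed.

Lemma gen_op f args X : f < m -> size args = ar f -> {subset args <= X} -> gen 1 X [:: vop f args].
Proof.
move=> lf sa al; exists [:: vop f args]; split=> //=.
  by split=> //; exists f, args.
by move=> u uv; rewrite mem_cat uv orbT.
Qed.

Lemma gen_all k X Y : (forall v, v \in Y -> gen k X [:: v]) -> gen (size Y * k) X Y.
Proof.
elim: Y => [|v Y IH] H; first by apply: gen_refl.
rewrite mulSn -[v :: Y]cat1s; apply: gen_trans; first by apply: H; rewrite mem_head.
apply: (@gen_weaken _ _ X _ Y) (IH _) => // [u|u uY]; first by rewrite mem_cat => ->.
by apply: H; rewrite inE uY orbT.
Qed.

(* Each failure of [Q] is repaired by a short derivation that increases the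
   bounded measure [mu], so [Q] holds after at most [M] repairs. *)
Lemma grow (Q : seq (vec I) -> Prop) (mu : seq (vec I) -> nat) M c :
  (forall X, mu X <= M) ->
  (forall X, Q X \/ exists s, [/\ size s <= c, derivation X s & mu X < mu (X ++ s)]) ->
  forall X, exists s, [/\ size s <= M * c, derivation X s & Q (X ++ s)].
Proof.
move=> le_M H X; suff G k Y : M - mu Y <= k ->
    exists s, [/\ size s <= k * c, derivation Y s & Q (Y ++ s)].
  by apply: G; apply: leq_subr.
elim: k Y => [|k IH] Y le.
  exists [::]; split=> //; rewrite cats0; case: (H Y) => // -[s [_ _ lt]].
  by have := le_M (Y ++ s); lia.
case: (H Y) => [q|[s [ls D lt]]]; first by exists [::]; rewrite cats0.
have [|t [lt' D' q]] := IH (Y ++ s); first by have := le_M (Y ++ s); lia.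
exists (s ++ t); split; first by rewrite size_cat mulSn leq_add.
  exact: derivation_cat D'.
by rewrite catA.
Qed.

End OnePower.

(** * Change of coordinates between powers *)

Section Reindexing.
Variables (I J : finType) (phi : I -> J).

Definition pull (v : vec J) : vec I := [ffun i => v (phi i)].

Lemma pull_vop f args : pull (vop f args) = vop f (map pull args).
Proof.
apply/ffunP => i; rewrite !ffunE -map_comp; congr op.
by apply: eq_map => v; rewrite /= ffunE.
Qed.

Lemma derivation_pull X s : derivation X s -> derivation (map pull X) (map pull s).
Proof.
elim: s X => //= v s IH X [[f [args [lf sa al ->]]] D]; split; last exact: (IH _ D).
exists f, (map pull args); split=> //; rewrite ?size_map // ?pull_vop //.
by move=> u /mapP[w /al wX ->]; apply: map_f.
Qed.

Lemma gen_pull k X Y : gen k X Y -> gen k (map pull X) (map pull Y).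
Proof.
move=> [s [ls D sub]]; exists (map pull s); split; rewrite ?size_map //.
  exact: derivation_pull.
by move=> u /mapP[w /sub wXs ->]; rewrite -map_cat map_f.
Qed.

End Reindexing.

(** * Local Maltsev operations *)

Hypothesis op_idem : forall f x, f < m -> op f (nseq (ar f) x) = x.

Definition triples : finType := ('I_n * 'I_n * 'I_n)%type.
Definition coord_proj1 : vec triples := [ffun p => p.1.1].
Definition coord_proj2 : vec triples := [ffun p => p.1.2].
Definition coord_proj3 : vec triples := [ffun p => p.2].
Definition projs := [:: coord_proj1; coord_proj2; coord_proj3].

Lemma derivation_idem X s : derivation X s -> (forall v, v \in X -> forall x, v (x, x, x) = x) ->
  forall v, v \in X ++ s -> forall x, v (x, x, x) = x.
Proof.
elim: s X => [|u s IH] X /=; first by rewrite cats0.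
move=> [[f [args [lf sa al uE]]] D] HX v vin.
apply: (IH _ D); last by move: vin; rewrite !(inE, mem_cat) orbCA orbA.
move=> w; rewrite inE => /orP[/eqP ->|/HX //] x.
rewrite uE ffunE -[RHS](op_idem x lf); congr op; rewrite -sa.
have {al} : forall v : vec triples, v \in args -> v (x, x, x) = x by move=> v' /al /HX.
elim: args {sa uE} => //= a args IHa H; rewrite H ?mem_head // IHa // => v' vin'.
by apply: H; rewrite inE vin' orbT.
Qed.

(* Members of this power are ternary operations; [mal] is a Maltsev term operation. *)
Variable mal : vec triples.
Hypothesis mal_gen : forall C, closed_under_ops C -> (forall v, v \in projs -> C v) -> C mal.
Hypothesis mal_l : forall a b, mal (a, b, b) = a.
Hypothesis mal_r : forall c d, mal (c, c, d) = d.

(** Only the pair [(t(a,b,b), t(c,c,d))] matters. Extending the projections as long as new pairs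
    appear takes at most [n * n] steps; the pairs then form a subalgebra of the square, which
    contains the pair [(a, d)] of [mal]. *)
Lemma local_maltsev a b c d : exists t : vec triples,
  [/\ gen (n * n) projs [:: t], t (a, b, b) = a, t (c, c, d) = d & forall x, t (x, x, x) = x].
Proof.
pose h (v : vec triples) := (v (a, b, b), v (c, c, d)).
pose mu X := #|[set p in map h X]|.
pose Q X := forall f args, f < m -> size args = ar f -> {subset args <= X} ->
  h (vop f args) \in map h X.
have [||s [ls D q]] := @grow triples Q mu (n * n) 1 _ _ projs.
- move=> X; apply: leq_trans (max_card _) _.
  by rewrite card_prod !card_ord.
- move=> X; case: (classic (Q X)) => [|nq]; [by left | right].
  apply: NNPP => ns; apply: nq => f args lf sa al; apply: contraT => notin.
  case: ns; exists [:: vop f args]; split=> //=; first by split=> //; exists f, args.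
  rewrite /mu; apply: proper_card; apply/properP; split.
    by apply/subsetP => p; rewrite !inE map_cat mem_cat => ->.
  by exists (h (vop f args)); rewrite !inE // map_cat mem_cat mem_head orbT.
(* The pair of a value depends only on the pairs of the arguments, so these may be replaced by
   derived operations with the same pairs. *)
have hC : closed_under_ops (fun v => h v \in map h (projs ++ s)).
  move=> f args lf sa H.
  have [args' [sa' al' E]] : exists args', [/\ size args' = ar f, {subset args' <= projs ++ s}
        & map h args' = map h args].
    rewrite -sa; elim: args H {sa} => [|v args IH] H; first by exists [::].
    have [|args' [sa' al' E]] := IH; first by move=> u uin; apply: H; rewrite inE uin orbT.
    have /mapP[v' v'in vE] := H v (mem_head _ _).
    exists (v' :: args'); split; rewrite /= ?sa' ?E ?vE //.
    by move=> u; rewrite inE => /orP[/eqP ->|/al'].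
  suff -> : h (vop f args) = h (vop f args') by apply: q.
  have E1 : [seq v (a, b, b) | v : vec triples <- args] = [seq v (a, b, b) | v : vec triples <- args'].
    have := congr1 (map fst) E; rewrite -!map_comp => E'.
    by symmetry; rewrite (eq_map (g := fst \o h)) // E'; apply: eq_map.
  have E2 : [seq v (c, c, d) | v : vec triples <- args] = [seq v (c, c, d) | v : vec triples <- args'].
    have := congr1 (map snd) E; rewrite -!map_comp => E'.
    by symmetry; rewrite (eq_map (g := snd \o h)) // E'; apply: eq_map.
  by rewrite /h !ffunE E1 E2.
have /mapP[t tin] : h mal \in map h (projs ++ s).
  by apply: (mal_gen hC) => v vin; rewrite map_f // mem_cat vin.
rewrite /h mal_l mal_r => -[ta td].
exists t; split=> //.
  by exists s; rewrite -(muln1 (n * n)); split=> // u; rewrite inE => /eqP ->.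
move=> x; apply: (derivation_idem D) tin x => v.
by rewrite !inE => /or3P[] /eqP -> x; rewrite ffunE.
Qed.

(** * Forks and coordinatewise approximation *)

Section Chain.
Variable I : finType.
Implicit Types (X : seq (vec I)) (q g u w : vec I).

(** Hence a derivation of the ternary operation [t] from the projections becomes one of [t(x, y, z)]
    from [x], [y], [z], of the same length. *)
Lemma pull_projs (x y z : vec I) : map (pull (fun i => (x i, y i, z i))) projs = [:: x; y; z].
Proof. by congr [:: _; _; _]; apply/ffunP => i; rewrite !ffunE. Qed.

Lemma gen_local X (x y z : vec I) t : gen (n * n) projs [:: t] ->
  x \in X -> y \in X -> z \in X ->
  gen (n * n) X [:: pull (fun i => (x i, y i, z i)) t].
Proof.
move=> /(gen_pull (fun i => (x i, y i, z i))); rewrite pull_projs => G xX yX zX.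
by apply: gen_weaken G => // v; rewrite !inE => /or3P[] /eqP ->.
Qed.

(* With [t] the local Maltsev operation at coordinates [j] and [i], replacing [(w, u)]
   by [(t(q, u, w), t(q, u, u))] corrects coordinate [j] without damaging the others. *)
Lemma correct_coordinates X q f g i (js : seq I) :
  q \in X -> f \in X -> g \in X -> q i = f i -> (forall j, j \in js -> f j = g j) ->
  exists w u, [/\ gen (size js * (2 * (n * n))) X [:: w; u],
     forall j, f j = g j -> w j = u j, w i = g i, u i = f i & forall j, j \in js -> w j = q j].
Proof.
move=> qX fX gX qi; elim: js => [|j js IH] H.
  exists g, f; split=> //; apply: gen_refl => v.
  by rewrite !inE => /orP[] /eqP ->.
have [|w [u [G wu wi ui wq]]] := IH; first by move=> k kin; apply: H; rewrite inE kin orbT.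
(* Here [t(q j, u j, u j) = q j] and [t(q i, q i, g i) = g i]. Since [w j = u j], the first equation
   sets coordinate [j] to [q j]; the second keeps [g i] at [i]. Coordinates corrected before survive
   by idempotence. *)
have [t [Gt tj ti tid]] := local_maltsev (q j) (u j) (q i) (g i).
pose w' := pull (fun k => (q k, u k, w k)) t; pose u' := pull (fun k => (q k, u k, u k)) t.
exists w', u'; split.
- have G1 : gen (n * n) (X ++ [:: w; u]) [:: w'].
    by apply: gen_local => //; rewrite mem_cat ?qX // !inE eqxx ?orbT.
  have G2 : gen (n * n) (X ++ [:: w; u] ++ [:: w']) [:: u'].
    by apply: gen_local => //; rewrite !mem_cat ?qX // !inE eqxx ?orbT.
  have := gen_trans G (gen_trans G1 _); rewrite catA in G2 => /(_ _ _ G2).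
  apply: gen_weaken => // [|v]; first by rewrite /=; lia.
  by rewrite !inE => /orP[] ->; rewrite ?orbT.
- by move=> k E; rewrite !ffunE (wu _ E).
- by rewrite ffunE ui wi -qi ti.
- by rewrite ffunE ui -qi tid.
- move=> k; rewrite inE ffunE => kin.
  have E : f k = g k by apply: H; rewrite inE.
  case/orP: kin => [/eqP kj|kin]; last by rewrite -(wu _ E) wq // tid.
  by rewrite (wu _ E) kj tj.
Qed.

Definition rank (i : I) : nat := enum_rank i.
Definition agree_below k u w : bool := [forall j, (rank j < k) ==> (u j == w j)].

Definition fork X (p : I * 'I_n * 'I_n) : bool :=
  has (fun u => has (fun w => [&& u p.1.1 == p.1.2, w p.1.1 == p.2 & agree_below (rank p.1.1) u w]) X) X.

Lemma fork_sub X Y p : {subset X <= Y} -> fork X p -> fork Y p.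
Proof.
move=> sub /hasP[u uX /hasP[w wX h]].
by apply/hasP; exists u; [exact: sub | apply/hasP; exists w; first exact: sub].
Qed.

Definition chain_cost := #|I| * (2 * (n * n)).

(** The fork supplies [f] and [g] that agree below [i], with [f i = q i] and [g i = r i]. Correcting
    [g] towards [q] at all coordinates below [i] preserves its value at [i]. *)
Lemma use_fork X q r (i : I) : q \in X -> agree_below (rank i) q r -> fork X (i, q i, r i) ->
  exists2 w, gen chain_cost X [:: w] & agree_below (rank i).+1 w r.
Proof.
move=> qX qr /hasP[f fX /hasP[g gX /and3P[/eqP /= fi /eqP /= gi /forallP fg]]].
pose js := [seq j <- enum I | rank j < rank i].
have [||w [u [G _ wi _ wq]]] := @correct_coordinates X q f g i js qX fX gX.
- by rewrite fi.
- by move=> j; rewrite mem_filter => /andP[lt _]; apply/eqP; have := fg j; rewrite lt.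
exists w.
  apply: gen_weaken G => //; last by move=> v; rewrite !inE => ->.
  by rewrite /chain_cost leq_mul2r size_filter; apply/orP; right; rewrite cardE count_size.
apply/forallP => j; apply/implyP; rewrite ltnS leq_eqVlt => /orP[/eqP /val_inj /enum_rank_inj ->|lt].
  by rewrite wi gi.
rewrite wq; first by have := forallP qr j; rewrite lt.
by rewrite mem_filter lt mem_enum.
Qed.

(** Coordinates are treated in order of [rank]. If the fork needed at some coordinate is missing
    from [X], the current approximation [q] and [r] itself agree below that coordinate and so form
    this fork. *)
Lemma approximate X x0 r : x0 \in X ->
  gen (#|I| * chain_cost) X [:: r] \/
  exists q p, [/\ gen (#|I| * chain_cost) X [:: q], ~~ fork X p & fork [:: q; r] p].
Proof.
move=> x0X; suff G k : k <= #|I| -> (exists2 q, gen (k * chain_cost) X [:: q] & agree_below k q r) \/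
   exists q p, [/\ gen (#|I| * chain_cost) X [:: q], ~~ fork X p & fork [:: q; r] p].
  case: (G _ (leqnn _)) => [[q Gq /forallP qr]|]; [left | by right].
  suff -> : r = q by [].
  by apply/ffunP => j; apply/eqP; rewrite eq_sym; have := qr j; rewrite /rank ltn_ord.
elim: k => [|k IH] lk.
  left; exists x0; last by apply/forallP.
  by apply: gen_refl => v; rewrite inE => /eqP ->.
case: (IH (ltnW lk)) => [[q Gq qr]|]; [|by right].
pose i := enum_val (Ordinal lk); have rk : rank i = k by rewrite /rank enum_valK.
have Gq' : gen (#|I| * chain_cost) X [:: q].
  by apply: gen_weaken Gq => //; rewrite leq_mul2r ltnW ?orbT.
case: (boolP (fork X (i, q i, r i))) => [F|nF]; last first.
  right; exists q, (i, q i, r i); split=> //.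
  by rewrite /fork /= !eqxx /= rk qr !orbT.
have [|||w Gw wr] := @use_fork (X ++ [:: q]) q r i.
- by rewrite mem_cat inE eqxx orbT.
- by rewrite rk.
- by apply: fork_sub F => v; rewrite mem_cat => ->.
left; exists w; last by rewrite -rk.
rewrite mulSn addnC; apply: gen_weaken (gen_trans Gq Gw) => // v.
by rewrite !inE => ->; rewrite orbT.
Qed.

Variable kmax : nat.
Hypothesis ar_le : forall f, f < m -> ar f <= kmax.

(** One repair per possible fork, each deriving up to [kmax] arguments, one value and one
    approximation; the last summand derives the wanted tuple. *)
Definition slp_cost := (#|I| * n * n) * ((kmax * (#|I| * chain_cost)) + (1 + #|I| * chain_cost)) + #|I| * chain_cost.

(** For [Y] containing [x0], [Q Y] says that the tuples derivable from [Y] in [N] steps form a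
    subalgebra. Where it fails, [approximate] gives a fork that is new to [Y], so [grow] applies
    with the number of forks as measure; once [Q] holds, that subalgebra contains [r]. *)
Theorem short_derivation X x0 r : x0 \in X ->
  (forall C, closed_under_ops C -> (forall v, v \in X -> C v) -> C r) -> gen slp_cost X [:: r].
Proof.
move=> x0X rX; set N := #|I| * chain_cost.
pose Q Y := forall f args, f < m -> size args = ar f -> (forall v, v \in args -> gen N Y [:: v]) ->
  x0 \in Y -> gen N Y [:: vop f args].
pose mu Y := #|[set p | fork Y p]|.
have [||s [ls D q]] := @grow I Q mu (#|I| * n * n) (kmax * N + (1 + N)) _ _ X.
- by move=> Y; apply: leq_trans (max_card _) _; rewrite !card_prod !card_ord.
- move=> Y; case: (classic (Q Y)) => [|nq]; [by left | right].
  apply: NNPP => ns; apply: nq => f args lf sa al x0Y; apply: NNPP => ng.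
  case: (approximate (vop f args) x0Y) => // -[q' [p [Gq pN pF]]]; case: ns.
  have G1 := gen_all al.
  have G2 : gen 1 (Y ++ args) [:: vop f args].
    by apply: gen_op => // v vin; rewrite mem_cat vin orbT.
  have G3 : gen N ((Y ++ args) ++ [:: vop f args]) [:: q'].
    by apply: gen_weaken Gq => // v vin; rewrite !mem_cat vin.
  have [s [ls D sub]] := gen_trans G1 (gen_trans G2 G3).
  exists s; split=> //.
    by apply: leq_trans ls _; rewrite leq_add2r leq_mul2r sa ar_le ?orbT.
  apply: proper_card; apply/properP; split.
    by apply/subsetP => p'; rewrite !inE; apply: fork_sub => v; rewrite mem_cat => ->.
  exists p; rewrite !inE //; apply: fork_sub pF => v vin; apply: sub.
  by rewrite mem_cat; move: vin; rewrite !inE => /orP[] ->; rewrite ?orbT.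
have Gr : gen N (X ++ s) [:: r].
  apply: (rX (fun v => gen N (X ++ s) [:: v])) => [f args lf sa al|v vX].
    by apply: q => //; rewrite mem_cat x0X.
  by apply: gen_weaken (gen_refl (X := X ++ s) (Y := [:: v]) _) => // u; rewrite inE mem_cat => /eqP ->; rewrite vX.
have Gs : gen (#|I| * n * n * (kmax * N + (1 + N))) X s.
  by exists s; split=> // v vs; rewrite mem_cat vs orbT.
by apply: gen_weaken (gen_trans Gs Gr) => // v; rewrite mem_cat orbC => ->.
Qed.

End Chain.
End Powers.

(** * Programming the certificate machine *)

Section Homomorphism.
Variables (T U : Type) (m : nat) (ar : nat -> nat).
Variables (app : nat -> seq T -> T) (app' : nat -> seq U -> U) (d : T) (d' : U) (g : T -> U).
Hypothesis g_app : forall f args, f < m -> size args = ar f -> g (app f args) = app' f (map g args).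

Definition map_state (s : state T) : state U := let: (L, args, V) := s in (L, map g args, map g V).

(** Which operation acts, and when, depends on the bits and the arities but never on the values, so
    a homomorphism commutes with whole runs. *)
Lemma run_map L args V cert : L != [::] -> all (fun f => f < m) L -> 0 < size V ->
  foldl (astep ar app' d') (map_state (L, args, V)) cert =
  map_state (foldl (astep ar app d) (L, args, V) cert).
Proof.
elim: cert L args V => // b cert IH L args [|v V] // L0 aL _.
case: L L0 aL => // h L _ /andP[lh aL].
have E : astep ar app' d' (map_state (h :: L, args, v :: V)) b = map_state (astep ar app d (h :: L, args, v :: V) b).
  rewrite /= !rot1_cons -!map_rcons size_map; case: b => //=.
  by case: eqP => [sa|_] //=; rewrite [in RHS]map_rcons g_app.
rewrite -[LHS]/(foldl (astep ar app' d') (astep ar app' d' (map_state (h :: L, args, v :: V)) b) cert) E.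
case: b E => [|] _ /=; last by rewrite IH //= ?lh // rot1_cons size_rcons.
case: eqP => _; rewrite IH //= ?lh //; rewrite ?size_rcons ?size_rot //.
- by rewrite rot1_cons -size_eq0 size_rcons.
- by rewrite rot1_cons all_rcons lh.
Qed.

End Homomorphism.

Section Programming.
Variables (T : eqType) (m kmax : nat) (ar : nat -> nat) (app : nat -> seq T -> T) (d : T).
Hypothesis ar_bounds : forall f, f < m -> 0 < ar f <= kmax.

Notation run := (foldl (astep ar app d)).

Lemma run_rotate L args V v : v \in V -> exists2 bits, size bits <= size V &
  exists2 V', run (L, args, V) bits = (L, args, V') & perm_eq V' V /\ head d V' = v.
Proof.
move=> vV; have [i V' E] := rot_to vV; pose k := minn i (size V).
have kE : rot k V = v :: V'.
  rewrite /k; case: (leqP i (size V)) => [le|lt]; rewrite ?E //.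
  by rewrite rot_size -E rot_oversize // ltnW.
exists (nseq k false); first by rewrite size_nseq /k geq_minr.
exists (v :: V'); last by rewrite -{1}kE perm_rot.
rewrite -kE; have : k <= size V by rewrite /k geq_minr.
elim: k {kE} => [|k IH] lk; first by rewrite rot0.
by rewrite -[in nseq _ _](addn1 k) nseqD foldl_cat IH ?(ltnW lk) // rotS.
Qed.

Lemma run_take h L args more V : more != [::] -> {subset more <= V} ->
  size args + size more = ar h -> exists2 bits, size bits <= size more * (size V).+1 &
  exists2 V', run (h :: L, args, V) bits = (rcons L h, [::], rcons V' (app h (args ++ more))) & perm_eq V' V.
Proof.
elim: more args V => // v more IH args V _ sub sz.
have vV : v \in V by apply: sub; rewrite mem_head.
have [bits lb [V1 E [p1 hv]]] := run_rotate (h :: L) args vV.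
have szE : size (rcons args v) + size more = ar h by rewrite size_rcons addSnnS.
have p1' : perm_eq (rot 1 V1) V by rewrite perm_rot.
case: (altP (more =P [::])) => [m0|m0].
  exists (bits ++ [:: true]); first by rewrite size_cat /= addn1 m0 mul1n.
  exists (rot 1 V1) => //; rewrite foldl_cat E /= hv; rewrite m0 addn0 in szE.
  by rewrite szE eqxx rot1_cons m0 cats1.
have [|bits2 lb2 [V2 E2 p2]] := IH (rcons args v) (rot 1 V1) m0 _ szE.
  by move=> u um; rewrite (perm_mem p1'); apply: sub; rewrite inE um orbT.
exists (bits ++ true :: bits2).
  by move: lb2; rewrite size_cat /= (perm_size p1'); lia.
exists V2; last exact: perm_trans p2 p1'.
rewrite foldl_cat E /= hv; case: eqP => [e|_]; last by rewrite E2 cat_rcons.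
by case: (more) m0 szE e => //= u l _; lia.
Qed.

(** The operations take turns, so those preceding [f] must be completed as well. They are fed copies
    of one available element, and their values remain as harmless extras. *)
Lemma run_op f args L V : f \in L -> all (fun f => f < m) L -> V != [::] ->
  {subset args <= V} -> size args = ar f ->
  exists2 bits, size bits <= (index f L).+1 * (kmax * (size V + index f L).+1) &
  exists2 LV, run (L, [::], V) bits = (LV.1, [::], LV.2) &
    [/\ perm_eq LV.1 L, size LV.2 <= size V + (index f L).+1 & {subset app f args :: V <= LV.2}].
Proof.
move: {2}(index f L) (erefl (index f L)) => j.
elim: j L V => [|j IH] [|h L] V //= iE fL /andP[lh aL] V0 sub sa; rewrite iE.
all: have /andP[ar0 ark] := ar_bounds lh.
- have hf : h = f by apply/eqP; move: iE; case: eqP.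
  subst h; have args0 : args != [::] by rewrite -size_eq0 sa -lt0n.
  have [bits lb [V' E p]] := @run_take f L [::] args V args0 sub sa.
  exists bits; first by apply: leq_trans lb _; rewrite mul1n addn0 leq_mul2r sa ark orbT.
  exists (rcons L f, rcons V' (app f args)) => //=; split.
  + by rewrite perm_rcons.
  + by rewrite size_rcons (perm_size p) addn1.
  + by move=> u; rewrite mem_rcons !inE (perm_mem p).
- have hf : h != f by move: iE; case: eqP.
  move: iE fL; rewrite (negPf hf) inE eq_sym (negPf hf) /= => -[iE] fL.
  case: V V0 sub => // v V _ sub.
  have s0 : size (nseq (ar h) v) = ar h by rewrite size_nseq.
  have n0 : nseq (ar h) v != [::] by rewrite -size_eq0 s0 -lt0n.
  have nsub : {subset nseq (ar h) v <= v :: V} by move=> u /nseqP[-> _]; rewrite mem_head.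
  have [bits lb [V' E p]] := @run_take h L [::] _ (v :: V) n0 nsub s0.
  set V1 := rcons V' _ in E.
  have sV1 : size V1 = (size (v :: V)).+1 by rewrite size_rcons (perm_size p).
  have subV : {subset v :: V <= V1}.
    by move=> u uV; rewrite /V1 mem_rcons [u \in _ :: V']inE (perm_mem p) uV orbT.
  have i2 : index f (rcons L h) = j by rewrite -cats1 index_cat fL.
  have [|||||bits2 lb2 [LV E2 [pL sV subLV]]] := IH (rcons L h) V1 i2.
  + by rewrite mem_rcons inE fL orbT.
  + by rewrite all_rcons lh.
  + by rewrite -size_eq0 sV1.
  + by move=> u /sub /subV.
  + exact: sa.
  exists (bits ++ bits2).
    rewrite size_cat s0 in lb *; rewrite sV1 in lb2.
    apply: leq_trans (leq_add lb lb2) _; rewrite [X in _ <= X]mulSn; apply: leq_add.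
      by apply: leq_mul => //; lia.
    by rewrite i2 addSnnS.
  exists LV; first by rewrite foldl_cat E E2.
  split; first by rewrite (perm_trans pL) // perm_rcons.
    by apply: leq_trans sV _; rewrite sV1; lia.
  move=> u; rewrite inE => /orP[/eqP ->|/subV uV1]; apply: subLV; rewrite inE ?eqxx //.
  by rewrite uV1 orbT.
Qed.

End Programming.

Section Derivations.
Variables (n m kmax : nat) (ar : nat -> nat) (op : nat -> seq 'I_n -> 'I_n) (I : finType) (d : vec n I).
Hypothesis ar_bounds : forall f, f < m -> 0 < ar f <= kmax.

(** One derivation step passes through at most [m] operations, each of which adds one element to the
    list. *)
Lemma run_derivation (X s V : seq (vec n I)) L : derivation m ar op X s ->
  {subset X <= V} -> V != [::] -> perm_eq L (iota 0 m) ->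
  exists2 bits, size bits <= size s * (m * (kmax * (size V + size s * m).+1)) &
  exists2 LV, foldl (astep ar (vop op (I := I)) d) (L, [::], V) bits = (LV.1, [::], LV.2) &
    size LV.2 <= size V + size s * m /\ {subset X ++ s <= LV.2}.
Proof.
elim: s X V L => [|v s IH] X V L /=.
  move=> _ sub V0 pL; exists [::] => //; exists (L, V) => //=; split; first by rewrite addn0.
  by move=> u; rewrite cats0 => /sub.
move=> [[f [args [lf sa al vE]]] D] sub V0 pL.
have aL : all (fun f => f < m) L by rewrite (perm_all _ pL); apply/allP => i; rewrite mem_iota.
have fL : f \in L by rewrite (perm_mem pL) mem_iota.
have iL : index f L < m by rewrite -[m in _ < m](size_iota 0) -(perm_size pL) index_mem.
have alV : {subset args <= V} by move=> u /al /sub.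
have [bits lb [[L1 V1] E [/= pL1 sV1 sub1]]] :=
  @run_op (vec n I) m kmax ar (vop op (I := I)) d ar_bounds f args L V fL aL V0 alV sa.
have sV1' : size V1 <= size V + m by apply: leq_trans sV1 _; rewrite leq_add2l.
have V10 : V1 != [::].
  by apply/eqP => V1E; have := sub1 v; rewrite V1E vE mem_head => /(_ isT).
have [||bits2 lb2 [[L2 V2] E2 [/= sV2 sub2]]] := IH _ V1 L1 D _ V10.
- by move=> u; rewrite inE => /orP[/eqP ->|/sub uV]; apply: sub1; rewrite inE ?vE ?eqxx // uV orbT.
- exact: perm_trans pL1 pL.
have sz : size V1 + size s * m <= size V + (size s).+1 * m by rewrite mulSn addnA leq_add2r.
exists (bits ++ bits2).
  rewrite size_cat mulSn; apply: leq_add.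
    apply: leq_trans lb _; apply: leq_mul => //; rewrite leq_mul2l ltnS; apply/orP; right.
    rewrite leq_add2l; apply: leq_trans (ltnW iL) _; rewrite mulSn; exact: leq_addr.
  apply: leq_trans lb2 _; rewrite !leq_mul2l ltnS sz !orbT //.
exists (L2, V2); first by rewrite foldl_cat E E2.
split; first exact: leq_trans sV2 sz.
by move=> u uX; apply: sub2; move: uX; rewrite !(inE, mem_cat) orbCA orbA.
Qed.

End Derivations.

(** * Polynomial bounds *)

Definition poly (f : nat -> nat) := exists c d, forall x, f x <= c * x ^ d + c.

Lemma poly_le f g : (forall x, f x <= g x) -> poly g -> poly f.
Proof. by move=> le [c [d H]]; exists c, d => x; apply: leq_trans (le x) (H x). Qed.

Lemma poly_const k : poly (fun=> k).
Proof. by exists k, 0 => x; rewrite leq_addl. Qed.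

Lemma poly_id : poly id.
Proof. by exists 1, 1 => x; rewrite expn1 mul1n leq_addr. Qed.

(** The summand 1 covers [x = 0] with [d = 0]. *)
Lemma pow_le x d e : x ^ d <= x ^ (d + e) + 1.
Proof.
case: x => [|x]; first by case: d => [|d]; [rewrite expn0 leq_addl | rewrite exp0n].
by apply: leq_trans (leq_addr _ _); rewrite leq_pexp2l // leq_addr.
Qed.

Lemma poly_add f g : poly f -> poly g -> poly (fun x => f x + g x).
Proof.
move=> [c [d Hf]] [c' [d' Hg]]; exists (2 * (c + c')), (d + d') => x.
have h1 := pow_le x d d'; have h2 := pow_le x d' d; rewrite [d' + d]addnC in h2.
apply: leq_trans (leq_add (Hf x) (Hg x)) _; nia.
Qed.

Lemma poly_mul f g : poly f -> poly g -> poly (fun x => f x * g x).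
Proof.
move=> [c [d Hf]] [c' [d' Hg]]; exists (4 * c * c'), (d + d') => x.
apply: leq_trans (leq_mul (Hf x) (Hg x)) _.
have h1 := pow_le x d d'; have h2 := pow_le x d' d; rewrite [d' + d]addnC in h2.
have e : x ^ (d + d') = x ^ d * x ^ d' by rewrite expnD.
rewrite -!mulnA !e in h1 h2 *.
have : (c * x ^ d + c) * (c' * x ^ d' + c') = c * c' * (x ^ d * x ^ d' + x ^ d + x ^ d' + 1) by lia.
move=> ->; rewrite (_ : 4 * (c * (c' * (x ^ d * x ^ d'))) + 4 * (c * c') = c * c' * (4 * (x ^ d * x ^ d') + 4)); last by lia.
by rewrite leq_mul2l; apply/orP; right; lia.
Qed.

Lemma poly_exp f d : poly f -> poly (fun x => f x ^ d).
Proof.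
move=> pf; elim: d => [|d IH]; first exact: poly_const.
by apply: poly_le (poly_mul pf IH) => x; rewrite expnS.
Qed.

(** The nesting depth of loops is fixed with the program and only affects the degree. *)
Lemma poly_bound c : poly (fun B => bound B c).
Proof.
elim: c => [|j a|j a IHa b IHb d IHd|a IHa b IHb|a IHa] /=.
- exact: poly_const.
- exact: poly_const.
- apply: (poly_le (g := fun B => bound B a + bound B b + bound B d + 1)); first by move=> x /=; lia.
  exact: poly_add (poly_add (poly_add IHa IHb) IHd) (poly_const 1).
- exact: poly_add.
- apply: (poly_le (g := fun B => B * (bound B a + 2) + 2)); first by move=> x /=; rewrite !addn2.
  exact: poly_add (poly_mul poly_id (poly_add IHa (poly_const 2))) (poly_const 2).
Qed.

(** * Correctness of the certificates *)

(** The induction hypothesis has to reach the terms inside argument lists, hence an induction on the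
    list under the [fix]. *)
Lemma term_nested_ind (P : term -> Prop) :
  (forall i, P (Var i)) ->
  (forall f args, (forall k, k < size args -> P (nth (Var 0) args k)) -> P (App f args)) ->
  forall t, P t.
Proof.
move=> HV HA; fix IH 1 => -[i|f args]; first exact: HV.
apply: HA; elim: args => [|t args IHa] [|k] lk.
- exact: (False_ind _ (notF lk)).
- exact: (False_ind _ (notF lk)).
- exact: (IH t).
- exact: (IHa k lk).
Qed.

Section Algebra.
Variable A : alg.
Hypotheses (A_wf : alg_wf A) (A_idem : Defs.idempotent A).

Notation n := (Defs.card A).
Notation m := (size (ops A)).
Let ar f := (nth (0, [::]) (ops A) f).1.
Let tab f := (nth (0, [::]) (ops A) f).2.
Let S := alg_size A.
Let op_bits := flatten [seq enc_op o | o <- ops A].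

Lemma universe_gt0 : 0 < n. Proof. by case/and3P: A_wf. Qed.
Lemma ops_gt0 : 0 < m. Proof. by case/and3P: A_wf => _; case: (ops A). Qed.

Lemma op_facts f : f < m -> [/\ 0 < ar f, size (tab f) = n ^ ar f & all (fun v => v < n) (tab f)].
Proof.
move=> lf; case/and3P: A_wf => _ _ /allP /(_ (nth (0, [::]) (ops A) f)).
by rewrite mem_nth // => /(_ isT) /and3P[h /eqP].
Qed.

Lemma pow_le_size f : f < m -> n ^ ar f <= S.
Proof.
move=> lf; rewrite /S /alg_size (big_nth (0, [::])) big_mkord (bigD1 (Ordinal lf)) //=.
exact: leq_addr.
Qed.

Lemma ops_le_size : m <= S.
Proof.
rewrite /S /alg_size -sum1_size; apply: leq_sum => o _; rewrite expn_gt0 universe_gt0 //.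
Qed.

Lemma universe_le_size : n <= S.
Proof.
apply: leq_trans (pow_le_size ops_gt0); have [h _ _] := op_facts ops_gt0.
by rewrite -{1}[n]expn1 leq_pexp2l // universe_gt0.
Qed.

Lemma size_unary v : size (unary v) = v.+1.
Proof. by rewrite size_rcons size_nseq. Qed.

Lemma size_enc_op_ge f : f < m -> (ar f).+1 + n ^ ar f <= size op_bits.
Proof.
move=> lf; have [_ <- _] := op_facts lf.
have -> : size op_bits = \sum_(o <- ops A) size (enc_op o).
  by rewrite /op_bits size_flatten /shape -map_comp sumnE big_map.
rewrite (big_nth (0, [::])) big_mkord (bigD1 (Ordinal lf)) //=.
apply: leq_trans (leq_addr _ _); rewrite size_cat size_unary leq_add2l.
rewrite size_flatten /shape -map_comp sumnE big_map -/(tab f) -sum1_size.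
by apply: leq_sum => v _ /=; rewrite size_unary.
Qed.

Lemma bounded_ops B : n + size op_bits < B -> forall f, f < m ->
  [/\ 0 < ar f, ar f < B, n ^ ar f <= B, size (tab f) = n ^ ar f & all (fun v => v < n) (tab f)].
Proof.
move=> lB f lf; have [h1 h2 h3] := op_facts lf; have := size_enc_op_ge lf.
by split=> //; lia.
Qed.

Section Large.
Hypothesis n_gt1 : 1 < n.

(** Over a one-element universe an operation contributes 1 to the size however large its arity; this
    is why that case is treated apart. *)
Lemma arity_le_size f : f < m -> ar f <= S.
Proof. by move=> lf; apply: leq_trans (pow_le_size lf); apply/ltnW/ltn_expl. Qed.

(** An operation of arity [k] takes at most [n ^ k * S] symbols for its table and, since
    [k < n ^ k], at most [n ^ k] for its arity. *)
Lemma size_enc : size (enc_alg A) <= S.+1 + S * (S + 2).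
Proof.
rewrite size_cat size_unary; apply: leq_add; first exact: universe_le_size.
rewrite size_flatten /shape -map_comp sumnE big_map.
rewrite {1}/S /alg_size big_distrl /= big_seq [X in _ <= X]big_seq; apply: leq_sum => o oA.
case/and3P: A_wf => _ _ /allP /(_ o oA) /and3P[o1 /eqP so ao].
rewrite size_cat size_unary mulnDr addnC; apply: leq_add.
  rewrite size_flatten /shape -map_comp sumnE big_map -so -sum1_size big_distrl /=.
  rewrite big_seq [X in _ <= X]big_seq; apply: leq_sum => v vo.
  by rewrite size_unary mul1n; apply: leq_trans (allP ao v vo) universe_le_size.
by rewrite muln2 -addnn; apply: leq_trans (ltn_expl _ n_gt1) (leq_addr _ _).
Qed.

Definition run_size (cert : seq bool) := size (enc_alg A) + (size cert).+1.

Lemma run_size_gt cert : n + size op_bits < run_size cert.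
Proof. by rewrite /run_size size_cat size_unary -/op_bits; lia. Qed.

Lemma eval_checker_alg cert :
  eval (run_size cert) checker (init_store nregs (enc_alg A) cert) rBad =
  ones (total_errors n (ops A) cert n).
Proof.
have lB := run_size_gt cert.
have -> : init_store nregs (enc_alg A) cert =
  memory (nseq (run_size cert) tick) (map Some (unary n ++ op_bits) ++ None :: map Some cert)
    [::] [::] [::] [::] [::] [::] [::] [::] [::] [::] [::] [::] [::] [::].
  by apply: functional_extensionality; rewrite /init_store /memory; do 19 (case=> [|] //); move=> r; rewrite nth_default.
have le3 : 3 + size cert <= run_size cert by rewrite /run_size size_cat size_unary; lia.
by rewrite (@eval_checker _ _ _ _ universe_gt0 _ (bounded_ops lB) ops_gt0) // -/op_bits; lia.
Qed.

Definition checks cert := forall x y, x < n -> y < n ->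
  forall V, V \in [:: [:: y; x; x]; [:: x; y; x]; [:: x; x; y]] -> head 0 (result n (ops A) cert V).2 = y.

Lemma checksP cert : checks cert <-> eval (run_size cert) checker (init_store nregs (enc_alg A) cert) rBad = [::].
Proof.
rewrite eval_checker_alg; have := total_errors_eq0 (bounded_ops (run_size_gt cert)) ops_gt0 cert.
rewrite -/(checks cert) => E; split=> [/E ->//|].
by case: total_errors E => // E _; apply/E.
Qed.

End Large.

Lemma apply_op_lt f args : f < m -> size args = ar f -> all (fun v => v < n) args ->
  apply_op n (nth (0, [::]) (ops A) f) args < n.
Proof. exact: (app_lt (bounded_ops (ltnSn _))). Qed.

Lemma indices_wf : iota 0 m != [::] /\ all (fun f => f < m) (iota 0 m).
Proof.
split; first by rewrite -size_eq0 size_iota -lt0n ops_gt0.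
by apply/allP => f; rewrite mem_iota.
Qed.

Notation term_step := (astep ar App (Var 0)).

Lemma term_run_wf cert L args V : L != [::] -> all (fun f => f < m) L -> 0 < size V ->
  all (term_wf A) args -> all (term_wf A) V ->
  0 < size (foldl term_step (L, args, V) cert).2 /\
  all (term_wf A) (foldl term_step (L, args, V) cert).2.
Proof.
elim: cert L args V => // b cert IH [//|h L] args [//|v V] _ /andP[lh aL] _ aa /andP[wv aV] /=.
have aa' : all (term_wf A) (rcons args v) by rewrite all_rcons wv.
have aV' : all (term_wf A) (rcons V v) by rewrite all_rcons wv.
rewrite !rot1_cons; case: b => /=; last first.
  by apply: IH => //=; rewrite ?lh ?size_rcons.
case: eqP => [sa|_]; last by apply: IH => //=; rewrite ?lh ?size_rcons.
have wapp : term_wf A (App h (rcons args v)) by rewrite /= lh -/(ar h) sa eqxx.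
apply: IH => //.
- by case: (L).
- by rewrite all_rcons lh.
- by rewrite size_rcons.
- by rewrite all_rcons wapp.
Qed.

(** The certificate is run on terms, starting from the three variables. Evaluation maps this run to
    the runs on numbers, so the head of the final list is a minority term. *)
Lemma checks_minority cert : checks cert -> has_minority_term A.
Proof.
move=> H; have [L0 aL] := indices_wf.
pose s := foldl term_step (iota 0 m, [::], [:: Var 0; Var 1; Var 2]) cert.
have [V0 wV] : 0 < size s.2 /\ all (term_wf A) s.2 by apply: term_run_wf.
have E x y z : (result n (ops A) cert [:: x; y; z]).2 = map (term_eval A x y z) s.2.
  have := @run_map term nat m ar App (app n (ops A)) (Var 0) 0 (term_eval A x y z)
    (fun f args _ _ => erefl) (iota 0 m) [::] [:: Var 0; Var 1; Var 2] cert L0 aL isT.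
  by rewrite /= /result /initial /step -/s => ->; case: (s) => [[? ?] ?].
exists (head (Var 0) s.2); split; first by case: (s.2) V0 wV => //= t V _ /andP[].
move=> x y lx ly; have hE a b c : term_eval A a b c (head (Var 0) s.2) = head 0 (result n (ops A) cert [:: a; b; c]).2.
  by rewrite E; case: (s.2) V0.
by rewrite !hE; split; apply: (H x y lx ly); rewrite !inE eqxx ?orbT.
Qed.

(** * From a minority term to a certificate *)

Section Completeness.
Variable x0 : 'I_n.

Definition op f (args : seq 'I_n) : 'I_n :=
  insubd x0 (apply_op n (nth (0, [::]) (ops A) f) (map val args)).

Lemma val_op f args : f < m -> size args = ar f ->
  val (op f args) = apply_op n (nth (0, [::]) (ops A) f) (map val args).
Proof.
move=> lf sa; rewrite val_insubd apply_op_lt ?size_map //.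
by apply/allP => u /mapP[i _ ->]; exact: ltn_ord.
Qed.

Lemma op_idempotent f (x : 'I_n) : f < m -> op f (nseq (ar f) x) = x.
Proof.
move=> lf; apply: val_inj; rewrite val_op ?size_nseq // map_nseq.
by apply: A_idem; [apply: mem_nth | apply: ltn_ord].
Qed.

Definition term_vec (I : finType) (x y z : vec n I) t : vec n I :=
  [ffun i => insubd x0 (term_eval A (x i) (y i) (z i) t)].

Lemma val_term_vec (I : finType) (x y z : vec n I) t i : term_wf A t ->
  val (term_vec x y z t i) = term_eval A (x i) (y i) (z i) t.
Proof.
rewrite ffunE val_insubd => wt; suff -> : term_eval A (x i) (y i) (z i) t < n by [].
elim/term_nested_ind: t wt => [j|f args IH] /=; first by case: j => [|[|[|]]] //= _; rewrite ltn_ord.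
case/and3P => lf /eqP sa aw; apply: apply_op_lt => //; first by rewrite size_map.
by apply/(all_nthP 0); rewrite size_map => k lk; rewrite (nth_map (Var 0)) //; apply: IH => //; apply: (all_nthP (Var 0) aw).
Qed.

Lemma term_vec_app (I : finType) (x y z : vec n I) f args : term_wf A (App f args) ->
  term_vec x y z (App f args) = vop op f (map (term_vec x y z) args).
Proof.
move=> wt; apply/ffunP => i; apply: val_inj; rewrite val_term_vec //.
move: wt => /= /and3P[lf /eqP sa aw].
rewrite ffunE val_op ?size_map // -!map_comp; congr apply_op.
by elim: args aw {sa} => //= t args IH /andP[wt /IH ->]; rewrite val_term_vec.
Qed.

(** Subalgebras are closed under term operations; the form is that required of [mal] and of the
    target tuple in [short_derivation]. *)
Lemma term_vec_closed (I : finType) (x y z : vec n I) (C : vec n I -> Prop) t :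
  closed_under_ops m ar op C -> C x -> C y -> C z -> term_wf A t -> C (term_vec x y z t).
Proof.
move=> cC Cx Cy Cz; elim/term_nested_ind: t => [j|f args IH] wt.
  suff [->|->|->] : [\/ term_vec x y z (Var j) = x, term_vec x y z (Var j) = y | term_vec x y z (Var j) = z] by [].
  move: wt => /=; case: j => [|[|[|]]] //= _.
  - by constructor 1; apply/ffunP => i; apply: val_inj; rewrite val_term_vec.
  - by constructor 2; apply/ffunP => i; apply: val_inj; rewrite val_term_vec.
  - by constructor 3; apply/ffunP => i; apply: val_inj; rewrite val_term_vec.
rewrite term_vec_app //; move: wt => /= /and3P[lf /eqP sa aw].
apply: cC; rewrite ?size_map // => v.
have {aw} : forall k, k < size args -> C (term_vec x y z (nth (Var 0) args k)).
  by move=> k lk; apply: IH => //; apply: (all_nthP (Var 0) aw).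
elim: args {IH sa} => //= t args IH H; rewrite inE => /orP[/eqP ->|]; first exact: (H 0).
by apply: IH => k; apply: (H k.+1).
Qed.

(** A pair [(x, y)] together with the index of one of the three identities. *)
Definition coordinate : finType := ('I_n * 'I_n * 'I_3)%type.
Definition pattern (p : coordinate) : seq 'I_n :=
  let: (x, y, k) := p in nth [::] [:: [:: y; x; x]; [:: x; y; x]; [:: x; x; y]] k.
Definition generator j : vec n coordinate := [ffun p => nth x0 (pattern p) j].
Definition generators := [:: generator 0; generator 1; generator 2].
Definition target : vec n coordinate := [ffun p => p.1.2].

Lemma pattern_generators p : map (fun v : vec n coordinate => v p) generators = pattern p.
Proof. by rewrite /= !ffunE; case: p => [[x y] [[|[|[|]]] //]]. Qed.

Definition slp_size kmax := slp_cost n coordinate kmax.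

Definition cert_size kmax := slp_size kmax * (m * (kmax * (3 + slp_size kmax * m).+1)) +
  (3 + slp_size kmax * m).

(** The term yields both the Maltsev operation and the membership of [target] in the generated
    subalgebra. The short derivation is compiled into bits, and final rotations bring [target] to
    the head, where the verifier looks. *)
Lemma minority_checks kmax : (forall f, f < m -> ar f <= kmax) -> has_minority_term A ->
  exists2 cert, size cert <= cert_size kmax & checks cert.
Proof.
move=> ark [t [wt Ht]].
have Ht' (x y : 'I_n) := Ht x y (ltn_ord x) (ltn_ord y).
pose mal := term_vec (coord_proj1 n) (coord_proj2 n) (coord_proj3 n) t.
have mal_gen (C : vec n (triples n) -> Prop) : closed_under_ops m ar op C -> (forall v, v \in projs n -> C v) -> C mal.
  by move=> cC CX; apply: term_vec_closed wt => //; apply: CX; rewrite !inE eqxx ?orbT.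
have mal_l a b : mal (a, b, b) = a.
  by apply: val_inj; rewrite val_term_vec // !ffunE; case: (Ht' b a).
have mal_r c d : mal (c, c, d) = d.
  by apply: val_inj; rewrite val_term_vec // !ffunE; case: (Ht' c d).
have targetE : target = term_vec (generator 0) (generator 1) (generator 2) t.
  apply/ffunP => -[[x y] k]; apply: val_inj; rewrite val_term_vec // !ffunE.
  by case: k => [[|[|[|]]] //= lk]; case: (Ht' x y).
have [s [ls D sub]] : gen m ar op (slp_cost n coordinate kmax) generators [:: target].
  apply: (short_derivation op_idempotent mal_gen mal_l mal_r ark (mem_head _ _)) => C cC CX.
  by rewrite targetE; apply: term_vec_closed wt => //; apply: CX; rewrite !inE eqxx ?orbT.
have bnd f : f < m -> 0 < ar f <= kmax.
  by move=> lf; rewrite ark // andbT; case: (op_facts lf).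
have [bits lb [[L V] E [/= sV subV]]] := @run_derivation n m kmax ar op coordinate target bnd
  generators s generators (iota 0 m) D (fun _ h => h) isT (perm_refl _).
have tV : target \in V by apply: subV; apply: sub; rewrite mem_head.
have [bits2 lb2 [V2 E2 [p2 hV2]]] := @run_rotate (vec n coordinate) ar (vop op (I := coordinate)) target L [::] V target tV.
exists (bits ++ bits2).
  rewrite size_cat; apply: leq_add; [apply: leq_trans lb _ | apply: leq_trans lb2 (leq_trans sV _)].
    by rewrite !leq_mul // ltnS leq_add2l leq_mul.
  by rewrite leq_add2l leq_mul.
have V20 : 0 < size V2 by rewrite (perm_size p2); case: (V) tV.
move=> x y lx ly W hW.
have [k Wk] : exists k, W = map val (pattern (Ordinal lx, Ordinal ly, k)).
  by move: hW; rewrite !inE => /or3P[] /eqP ->; [exists ord0 | exists (inord 1) | exists ord_max]; rewrite /= ?inordK.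
pose p : coordinate := (Ordinal lx, Ordinal ly, k).
have [L0 aL] := indices_wf.
have R : foldl (astep ar (vop op (I := coordinate)) target) (iota 0 m, [::], generators) (bits ++ bits2)
    = (L, [::], V2) by rewrite foldl_cat E E2.
(* Projection to coordinate [p] is a homomorphism, mapping the run on tuples to the verifier's run
   on numbers. *)
pose g (v : vec n coordinate) : nat := v p.
have gE f args : f < m -> size args = ar f -> g (vop op f args) = app n (ops A) f (map g args).
  by move=> lf sa; rewrite /g ffunE val_op ?size_map // -map_comp.
have := @run_map (vec n coordinate) nat m ar (vop op (I := coordinate)) (app n (ops A)) target 0
  g gE (iota 0 m) [::] generators (bits ++ bits2) L0 aL isT.
rewrite R /map_state (_ : map g generators = W); last by rewrite Wk -(pattern_generators p) -map_comp.
rewrite /result /initial /step => ->.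
by case: (V2) V20 hV2 => //= v W2 _ ->; rewrite /g ffunE.
Qed.

End Completeness.
End Algebra.

(** * Bounds in terms of the input size, and the theorem *)

Definition slp_bound S :=
  let N := S * S * 3 in let C := N * (N * (2 * (S * S))) in
  (N * S * S) * (S * C + (1 + C)) + C.

Definition cert_bound S :=
  slp_bound S * (S * (S * (4 + slp_bound S * S))) + (3 + slp_bound S * S).

Lemma poly_slp_bound : poly slp_bound.
Proof.
rewrite /slp_bound /=.
repeat first [exact: poly_id | exact: poly_const | apply: poly_add | apply: poly_mul].
Qed.

Lemma poly_cert_bound : poly cert_bound.
Proof.
have ps := poly_slp_bound; rewrite /cert_bound.
by repeat first [exact: ps | exact: poly_id | exact: poly_const | apply: poly_add | apply: poly_mul].
Qed.

Definition time_bound c B := bound B c * (2 * (B + bound B c) + 2) + 2.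

Lemma poly_time_bound c : poly (time_bound c).
Proof.
have pb := poly_bound c; rewrite /time_bound.
by repeat first [exact: pb | exact: poly_id | exact: poly_const | apply: poly_add | apply: poly_mul].
Qed.

Lemma cert_size_le A : alg_wf A -> cert_size A (alg_size A) <= cert_bound (alg_size A).
Proof.
move=> wf; have ln := universe_le_size wf; have lm := ops_le_size wf.
have lN : #|coordinate A| <= alg_size A * alg_size A * 3 by rewrite !card_prod !card_ord !leq_mul.
have ls : slp_size A (alg_size A) <= slp_bound (alg_size A).
  rewrite /slp_size /slp_cost /slp_bound /chain_cost.
  by rewrite !(leq_add, leq_mul).
by rewrite /cert_size /cert_bound [4 + _]addSn !(ltnS, leq_add, leq_mul).
Qed.

Theorem theorem6p5 : MINORITY_in_NP.
Proof.
have [ct [dt Ht]] := poly_time_bound checker.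
(* [G] bounds the length of the initial tape: the encoded algebra, then the mark and the
   certificate. *)
pose G S := S + 1 + S * (S + 2) + (cert_bound S + 1).
have pG : poly G.
  have pc := poly_cert_bound; rewrite /G.
  by repeat first [exact: pc | exact: poly_id | exact: poly_const | apply: poly_add | apply: poly_mul].
(* One polynomial for the certificate length, the running time and the two steps of the one-element
   shortcut. *)
have [c [d HF]] : poly (fun S => cert_bound S + (ct * G S ^ dt + ct) + 2).
  have pc := poly_cert_bound; have pe := poly_exp dt pG.
  by repeat first [exact: pc | exact: pe | exact: poly_id | exact: poly_const | apply: poly_add | apply: poly_mul].
exists (machine nregs checker rBad), c, d => A wf idem; set S := alg_size A.
have := HF S; set F := c * S ^ d + c => leF.
have n_gt0 := universe_gt0 wf.
have regs := checker_registers.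
case: (ltnP 1 (Defs.card A)) => [n_gt1|n_le1]; last first.
  (* Over one element both sides hold: a variable is a minority term, and the machine accepts on
     seeing the second symbol. *)
  have n1 : Defs.card A = 1 by lia.
  split=> _.
    exists [::]; split=> //.
    have [w' ->] : exists w', enc_alg A = [:: true, false & w'] by rewrite /enc_alg n1; eexists.
    have [t [lt acc]] := @accepts_short nregs checker rBad w' [::] _ erefl.
    by exists t; split=> //; apply: leq_trans lt _; lia.
  exists (Var 0); split=> //= x y; rewrite n1 !ltnS !leqn0 => /eqP -> /eqP ->.
  by split.
have [w' wE] : exists w', enc_alg A = [:: true, true & w'].
  by rewrite /enc_alg; case: (Defs.card A) n_gt1 => [|[|k]] // _; eexists.
split=> [min|[cert [_ acc]]].
- have x0 : 'I_(Defs.card A) := Ordinal n_gt0.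
  have [cert lc ch] := minority_checks wf idem x0 (arity_le_size n_gt1) min.
  have lcb := leq_trans lc (cert_size_le wf).
  exists cert; split; first by apply: leq_trans lcb _; rewrite -/S; lia.
  have := proj1 (checksP wf n_gt1 cert) ch; rewrite /run_size wE => ev.
  have [t [lt acc]] := @machine_accepts nregs checker rBad w' cert true isT regs isT erefl ev.
  exists t; split=> //; apply: leq_trans lt _.
  rewrite -wE; apply: leq_trans (Ht (size (enc_alg A) + (size cert).+1)) _.
  have lB : size (enc_alg A) + (size cert).+1 <= G S.
    by rewrite /G !addn1; apply: leq_add; first exact: size_enc.
  have le_pow : (size (enc_alg A) + (size cert).+1) ^ dt <= G S ^ dt.
    by case: (dt) => // e; rewrite leq_exp2r.
  by have := leq_mul (leqnn ct) le_pow; lia.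
- apply: (checks_minority wf (cert := cert)); apply/(checksP wf n_gt1).
  rewrite /run_size; move: acc; rewrite wE; exact: machine_accepts_inv.
Qed.
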